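(* Let $A_0^{-1/2}DA_0^{-1/2}$ be a bounded self-adjoint operator in $H$. (a) If $\mu\ge2$, then $\sigma(\mathcal A)\subset(-\infty,0)$ if $\gamma=\infty$, and $\sigma(\mathcal A)\subset[-\gamma,0)$ if $\gamma<\infty$. If, in addition, $\delta>0$ (and hence $\beta>0$) with $\beta\delta>4$, then \[ \sigma(\mathcal A)\subset\begin{cases}\Big(-\infty,-\frac\beta2\Big(1+\sqrt{1-\frac4{\beta\delta}}\Big)\Big]\cup\Big[-\frac\beta2\Big(1-\sqrt{1-\frac4{\beta\delta}}\Big),0\Big)&\text{if }\gamma=\infty,\\[1.5ex]\Big[-\gamma,-\frac\beta2\Big(1+\sqrt{1-\frac4{\beta\delta}}\Big)\Big]\cup\Big[-\frac\beta2\Big(1-\sqrt{1-\frac4{\beta\delta}}\Big),0\Big)&\text{if }\gamma<\infty.\end{cases} \] (b) If $0<\mu<2$ (and hence $\beta>0$), then: if $\gamma=\infty$, \[ \sigma(\mathcal A)\subset\Big\{\lambda\in\mathbb C\ \Big|\ -\infty\le\mathrm{Re}\,\lambda\le-\frac\beta2,\ |\mathrm{Im}\,\lambda|\le\frac{\sqrt{4-\mu^2}}\mu|\mathrm{Re}\,\lambda|\Big\}\cup\Big[-\frac\beta2,0\Big); \] if $\gamma<\infty$, \[ \sigma(\mathcal A)\subset\Big[-\gamma,-\frac\gamma2\Big]\cup\Big\{\lambda\in\mathbb C\ \Big|\ -\frac\gamma2\le\mathrm{Re}\,\lambda\le-\frac\beta2,\ |\mathrm{Im}\,\lambda|\le\frac{\sqrt{4-\mu^2}}\mu|\mathrm{Re}\,\lambda|\Big\}\cup\Big[-\frac\beta2,0\Big).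 \] If, in addition to $0<\mu<2$, also $\delta>0$, then: if $\gamma=\infty$, \[ \begin{aligned} \sigma(\mathcal A)\subset{}&\Big(-\infty,-\frac2\delta\Big)\cup\Big\{\lambda\in\mathbb C\ \Big|\ -\frac2\delta\le\mathrm{Re}\,\lambda\le-\frac{\mu^2}{2\delta},\ \Big|\lambda+\frac1\delta\Big|\le\frac1\delta\Big\}\\ &\cup\Big\{\lambda\in\mathbb C\ \Big|\ -\frac{\mu^2}{2\delta}\le\mathrm{Re}\,\lambda\le-\frac\beta2,\ |\mathrm{Im}\,\lambda|\le\frac{\sqrt{4-\mu^2}}\mu|\mathrm{Re}\,\lambda|\Big\}\cup\Big[-\frac\beta2,0\Big); \end{aligned} \] if $\gamma<\infty$ and $\mu^2<\gamma\delta$, \[ \begin{aligned} \sigma(\mathcal A)\subset{}&\Big[-\gamma,-\min\Big\{\frac2\delta,\frac\gamma2\Big\}\Big)\cup\Big\{\lambda\in\mathbb C\ \Big|\ -\min\Big\{\frac2\delta,\frac\gamma2\Big\}\le\mathrm{Re}\,\lambda\le-\frac{\mu^2}{2\delta},\ \Big|\lambda+\frac1\delta\Big|\le\frac1\delta\Big\}\\ &\cup\Big\{\lambda\in\mathbb C\ \Big|\ -\frac{\mu^2}{2\delta}\le\mathrm{Re}\,\lambda\le-\frac\beta2,\ |\mathrm{Im}\,\lambda|\le\frac{\sqrt{4-\mu^2}}\mu|\mathrm{Re}\,\lambda|\Big\}\cup\Big[-\frac\beta2,0\Big); \end{aligned} \] if $\gamma<\infty$ and $\mu^2\ge\gamma\delta$,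 \[ \sigma(\mathcal A)\subset\Big[-\gamma,-\frac\gamma2\Big)\cup\Big\{\lambda\in\mathbb C\ \Big|\ -\frac\gamma2\le\mathrm{Re}\,\lambda\le-\frac\beta2,\ |\mathrm{Im}\,\lambda|\le\frac{\sqrt{4-\mu^2}}\mu|\mathrm{Re}\,\lambda|\Big\}\cup\Big[-\frac\beta2,0\Big). \]
   Context: $H$ is a (complex) Hilbert space with inner product $\langle\cdot,\cdot\rangle$ and norm $\|\cdot\|$. $A_0:\mathcal D(A_0)\subset H\to H$ is a self-adjoint, uniformly positive linear operator with $0\in\rho(A_0)$. $H_{1/2}:=\mathcal D(A_0^{1/2})$ with norm $\|z\|_{H_{1/2}}=\|A_0^{1/2}z\|$ and inner product $\langle x,y\rangle_{H_{1/2}}=\langle A_0^{1/2}x,A_0^{1/2}y\rangle$; $H_{-1/2}$ is the dual of $H_{1/2}$ with respect to the pivot space $H$, i.e. the completion of $H$ with respect to $\|A_0^{-1/2}z\|$ (so $A_0^{-1/2}$ extends to a bounded operator $H_{-1/2}\to H$); $\langle\cdot,\cdot\rangle_{H_{-1/2}\times H_{1/2}}$ is the duality pairing, with $\langle z',z\rangle_{H_{-1/2}\times H_{1/2}}=\langle z',z\rangle$ for $z'\in H$, $z\in H_{1/2}$. $H_1:=\mathcal D(A_0)$. $A_0$ extends to a bounded operator $H_{1/2}\to H_{-1/2}$, again denoted $A_0$. $D:H_{1/2}\to H_{-1/2}$ is a bounded linear operator such that $\mathrm{Re}\,\langle Dz,z\rangle_{H_{-1/2}\times H_{1/2}}\ge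 0$ for all $z\in H_{1/2}$, and $D$ maps $H_1$ into $H$. The operator $\mathcal A$ in $H_{1/2}\times H$ is $\mathcal A=\begin{bmatrix}0&I\\-A_0&-D\end{bmatrix}$ with $\mathcal D(\mathcal A)=\{(z,w)^\top\in H_{1/2}\times H_{1/2}\mid A_0z+Dw\in H\}$. Constants (with $z$ ranging over $H_{1/2}\setminus\{0\}$ and $\langle Dz,z\rangle$ short for $\langle Dz,z\rangle_{H_{-1/2}\times H_{1/2}}$): \[ \beta=\inf_z\frac{\mathrm{Re}\,\langle Dz,z\rangle}{\|z\|^2},\quad \gamma=\sup_z\frac{\mathrm{Re}\,\langle Dz,z\rangle}{\|z\|^2}\in[0,\infty],\quad \delta=\inf_z\frac{\mathrm{Re}\,\langle Dz,z\rangle}{\|z\|_{H_{1/2}}^2},\quad \mu=\inf_z\frac{\mathrm{Re}\,\langle Dz,z\rangle}{\|z\|\,\|z\|_{H_{1/2}}}. \] *)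

(* Defs.v *)
From HB Require Import structures.
From mathcomp Require Import all_boot all_order all_algebra.
From mathcomp Require Import all_classical all_reals all_analysis.
From mathcomp Require Import sesquilinear complex ring.
Set Implicit Arguments.
Unset Strict Implicit.
Unset Printing Implicit Defensive.
Import Order.TTheory GRing.Theory Num.Theory.
Import numFieldNormedType.Exports.
Local Open Scope classical_set_scope.
Local Open Scope ring_scope.
Local Open Scope complex_scope.

(* The inner product is linear in its first and conjugate-linear in its second
   argument. *)
HB.mixin Record CompleteNormedModule_isHilbert (R : realType) H
    & CompleteNormedModule R[i] H := {
  inner : {dot H for Num.conj};
  innerE : forall x : H, inner x x = `|x| ^+ 2 }.

#[short(type="hilbertType")]
HB.structure Definition Hilbert (R : realType) :=
  { H of CompleteNormedModule_isHilbert R H & CompleteNormedModule R[i] H }.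

(* Norms over R[i] are R[i]-valued; [rnorm x] is the same number in R. *)
Definition rnorm (R : realType) (V : normedModType R[i]) (x : V) : R :=
  complex.Re `|x|.

Section InnerTheory.
Context (R : realType).

Lemma rnormE (V : normedModType R[i]) (x : V) : `|x| = (rnorm x)%:C.
Proof. by rewrite /rnorm RRe_real ?ger0_real. Qed.

Lemma rnorm_ge0 (V : normedModType R[i]) (x : V) : 0 <= rnorm x.
Proof. by rewrite -lecR -rnormE normr_ge0. Qed.

Context (H : hilbertType R).
Implicit Types (x y z : H) (a : R[i]).

Lemma innerDl x y z : inner (x + y) z = inner x z + inner y z.
Proof. exact: linearDl. Qed.
Lemma innerDr x y z : inner x (y + z) = inner x y + inner x z.
Proof. exact: linearDr. Qed.
Lemma innerZl a x y : inner (a *: x) y = a * inner x y.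
Proof. exact: linearZl_LR. Qed.
Lemma innerZr a x y : inner x (a *: y) = Num.conj a * inner x y.
Proof. exact: linearZr_LR. Qed.
Lemma innerC x y : inner x y = Num.conj (inner y x).
Proof. by rewrite hermC expr0 mul1r. Qed.
Lemma inner0l y : inner 0 y = 0.
Proof. by rewrite -(scale0r (0 : H)) innerZl mul0r. Qed.
Lemma inner0r y : inner y 0 = 0.
Proof. by rewrite innerC inner0l rmorph0. Qed.

Lemma inner_cauchy_schwarz x y : `|inner x y| <= `|x| * `|y|.
Proof.
have [->|y0] := eqVneq y 0; first by rewrite inner0r !normr0 mulr0.
have ny0 : 0 < `|y| by rewrite normr_gt0.
pose a := inner x y / `|y| ^+ 2.
have : 0 <= inner (x - a *: y) (x - a *: y) by rewrite innerE exprn_ge0.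
rewrite -scaleNr innerDl !innerDr !innerZl !innerZr !innerE [inner y x]innerC.
have ca : Num.conj a = Num.conj (inner x y) / `|y| ^+ 2.
  by rewrite rmorphM fmorphV/= [X in _ / X]conj_Creal// rpredX ?ger0_real.
rewrite !rmorphN/= ca /a.
have -> : (`|x| ^+ 2 + - (Num.conj (inner x y) / `|y| ^+ 2) * inner x y +
  (- (inner x y / `|y| ^+ 2) * Num.conj (inner x y) +
   - (inner x y / `|y| ^+ 2) *
   (- (Num.conj (inner x y) / `|y| ^+ 2) * `|y| ^+ 2))) =
   `|x| ^+ 2 - `|inner x y| ^+ 2 / `|y| ^+ 2.
  rewrite normCK; field; exact: lt0r_neq0.
rewrite subr_ge0 ler_pdivrMr ?exprn_gt0// -exprMn => h.
by rewrite -ler_sqr ?nnegrE ?mulr_ge0.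
Qed.

End InnerTheory.

(* An operator in V is a function together with its domain; its values outside
   of the domain are irrelevant. *)
Record operator (R : realType) (V : normedModType R[i]) := Operator {
  dom : set V ;
  apply_op :> V -> V }.

Section Operators.
Context (R : realType).

Definition linear_operator (V : normedModType R[i]) (T : operator V) :=
  dom T 0 /\ forall (a : R[i]) (x y : V), dom T x -> dom T y ->
    dom T (a *: x + y) /\ T (a *: x + y) = a *: T x + T y.

Definition resolvent_set (V : normedModType R[i]) (T : operator V) : set R[i] :=
  [set l | exists B : {linear V -> V},
    [/\ continuous B,
        forall x, dom T (B x) /\ T (B x) - l *: B x = x
      & forall x, dom T x -> B (T x - l *: x) = x] ].

Definition spectrum (V : normedModType R[i]) (T : operator V) : set R[i] :=
  ~` resolvent_set T.

Variable H : hilbertType R.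
Implicit Types T S : operator H.

(* The last clause says T^* = T: the left member of the equivalence is the
   condition that y is in the domain of T^* with T^* y = z. *)
Definition selfadjoint T :=
  [/\ linear_operator T, dense (dom T)
    & forall y z, (forall x, dom T x -> inner (T x) y = inner x z) <->
                  (dom T y /\ T y = z)].

Definition bounded_selfadjoint (T : H -> H) :=
  selfadjoint (Operator setT T) /\ continuous T.

Definition nonnegative T := forall x, dom T x -> 0 <= inner (T x) x.

Definition uniformly_positive T :=
  exists2 c : R, 0 < c & forall x, dom T x -> c%:C * `|x| ^+ 2 <= inner (T x) x.

(* S = T^{1/2}: the (unique) nonnegative self-adjoint S with S S = T, equality
   of domains included. *)
Definition square_root T S :=
  [/\ selfadjoint S, nonnegative S,
      dom T = [set x | dom S x /\ dom S (S x)]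
    & forall x, dom T x -> T x = S (S x)].

End Operators.

(* A self-adjoint, uniformly positive A_0 with 0 in its resolvent set, bundled
   with A_0^{1/2}; the latter is determined by A_0. *)
Record positive_operator (R : realType) (H : hilbertType R) :=
  PositiveOperator {
    A0 : operator H ;
    sqrtA0 : operator H ;
    A0_selfadjoint : selfadjoint A0 ;
    A0_positive : uniformly_positive A0 ;
    A0_resolvent : resolvent_set A0 0 ;
    sqrtA0P : square_root A0 sqrtA0 }.

Section Hhalf.
Context (R : realType) (H : hilbertType R) (A : positive_operator H).

Lemma sqrtA0_linear : linear_operator (sqrtA0 A).
Proof. by case: (sqrtA0P A) => -[]. Qed.

Lemma sqrtA0_sym x y : dom (sqrtA0 A) x -> dom (sqrtA0 A) y ->
  inner (sqrtA0 A x) y = inner x (sqrtA0 A y).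
Proof.
move=> dx dy; case: (sqrtA0P A) => -[_ _ /(_ y (sqrtA0 A y))[_ h]] _ _ _.
exact: (h (conj dy erefl)).
Qed.

Lemma sqrtA0_0 : sqrtA0 A 0 = 0.
Proof.
have [d0 lin] := sqrtA0_linear.
have [_] := lin 1 0 0 d0 d0.
by rewrite !scale1r addr0 => /eqP; rewrite -subr_eq subrr eq_sym => /eqP.
Qed.

Lemma sqrtA0_inj x : dom (sqrtA0 A) x -> sqrtA0 A x = 0 -> x = 0.
Proof.
have [d0 lin] := sqrtA0_linear.
move=> dx Sx; have [_ _ domE SS] := sqrtA0P A.
have dAx : dom (A0 A) x by rewrite domE /=; split=> //; rewrite Sx.
have [c c0 /(_ x dAx)] := A0_positive A.
rewrite SS// Sx sqrtA0_0 inner0l pmulr_rle0 ?ltcR// => x0.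
by apply/eqP; rewrite -normr_eq0 -sqrf_eq0 eq_le x0 exprn_ge0.
Qed.

Lemma sqrtA0_surj x : exists2 y, dom (sqrtA0 A) y & sqrtA0 A y = x.
Proof.
have [_ _ domE SS] := sqrtA0P A.
have [B [_ BP _]] := A0_resolvent A.
have [dBx] := BP x; rewrite scale0r subr0 SS// => eBx.
by move: dBx; rewrite domE => -[_ dSBx]; exists (sqrtA0 A (B x)).
Qed.

Lemma sqrtA0_bounded_below :
  exists2 M : R[i], 0 <= M & forall x, dom (sqrtA0 A) x ->
    `|x| <= M * `|sqrtA0 A x|.
Proof.
have [_ _ domE SS] := sqrtA0P A.
have [B [Bc BP _]] := A0_resolvent A.
have /linear_bounded_continuous/linear_boundedP/pinfty_ex_gt0[M' M0' BM'] := Bc.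
pose M : R[i] := M'; have {M0'}M0 : 0 <= M := ltW M0'; have BM : forall x, `|B x| <= M * `|x| := BM'.
have M1 : 0 <= M + 1 by rewrite addr_ge0.
exists (M + 1) => //.
move=> x dx.
have [->|xn0] := eqVneq x 0; first by rewrite normr0 mulr_ge0.
have nx : 0 < `|x| by rewrite normr_gt0.
have [dBx] := BP x; rewrite scale0r subr0 SS// => eBx.
have := dBx; rewrite domE => -[dB dSB].
have e : inner x (B x) = `|sqrtA0 A (B x)| ^+ 2.
  by rewrite -innerE -sqrtA0_sym// eBx.
have SB : `|sqrtA0 A (B x)| <= (M + 1) * `|x|.
  rewrite -ler_sqr ?nnegrE ?mulr_ge0//.
  rewrite -e -(ger0_norm (_ : 0 <= inner x (B x))); last by rewrite e exprn_ge0.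
  apply: (le_trans (inner_cauchy_schwarz _ _)).
  apply: (@le_trans _ _ (`|x| * (M * `|x|))); first by rewrite ler_wpM2l.
  rewrite exprMn mulrCA -expr2 ler_wpM2r ?exprn_ge0// sqrrD mulr1 expr1n.
  by rewrite mulr2n addrA addrAC lerDr !addr_ge0 ?exprn_ge0.
have : `|x| ^+ 2 <= `|sqrtA0 A x| * ((M + 1) * `|x|).
  apply: (@le_trans _ _ (`|sqrtA0 A x| * `|sqrtA0 A (B x)|)); last first.
    by rewrite ler_wpM2l.
  rewrite -(ger0_norm (exprn_ge0 2 (normr_ge0 x))) -innerE.
  rewrite -[X in inner _ X]eBx -sqrtA0_sym//.
  exact: inner_cauchy_schwarz.
by rewrite expr2 mulrA ler_pM2r// mulrC.
Qed.

(* H_{1/2} = D(A_0^{1/2}) *)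
Definition Hhalf_pred : {pred H} := fun x => `[< dom (sqrtA0 A) x >].

Lemma Hhalf_submod : submod_closed Hhalf_pred.
Proof.
split; first by apply/asboolP; case: sqrtA0_linear.
move=> a x y /asboolP dx /asboolP dy; apply/asboolP.
by have [_ /(_ a x y dx dy)[]] := sqrtA0_linear.
Qed.

HB.instance Definition _ :=
  GRing.isSubmodClosed.Build R[i] H Hhalf_pred Hhalf_submod.

Record Hhalf := MkHhalf { Hhalf_val : H ; _ : Hhalf_val \in Hhalf_pred }.

HB.instance Definition _ := [isSub for Hhalf_val].
HB.instance Definition _ := [Choice of Hhalf by <:].
HB.instance Definition _ := [SubChoice_isSubLmodule of Hhalf by <:].

Lemma Hhalf_dom (z : Hhalf) : dom (sqrtA0 A) (val z).
Proof. exact/asboolP/(valP z). Qed.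

Definition Hhalf_norm (z : Hhalf) : R[i] := `|sqrtA0 A (val z)|.

Lemma sqrtA0_D (y z : Hhalf) :
  sqrtA0 A (val (y + z)) = sqrtA0 A (val y) + sqrtA0 A (val z).
Proof.
have [_ /(_ 1 _ _ (Hhalf_dom y) (Hhalf_dom z))[_]] := sqrtA0_linear.
by rewrite !scale1r.
Qed.

Lemma sqrtA0_Z a (z : Hhalf) : sqrtA0 A (val (a *: z)) = a *: sqrtA0 A (val z).
Proof.
have [d0 /(_ a _ _ (Hhalf_dom z) d0)[_]] := sqrtA0_linear.
by rewrite sqrtA0_0 !addr0.
Qed.

Lemma Hhalf_ler_normD y z : Hhalf_norm (y + z) <= Hhalf_norm y + Hhalf_norm z.
Proof. by rewrite /Hhalf_norm sqrtA0_D ler_normD. Qed.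

Lemma Hhalf_normrZ (a : R[i]) z : Hhalf_norm (a *: z) = `|a| * Hhalf_norm z.
Proof. by rewrite /Hhalf_norm sqrtA0_Z normrZ. Qed.

Lemma Hhalf_normr0_eq0 z : Hhalf_norm z = 0 -> z = 0.
Proof.
by move=> /normr0_eq0/(sqrtA0_inj (Hhalf_dom z)) z0; apply: val_inj.
Qed.

HB.instance Definition _ := Lmodule_isNormed.Build R[i] Hhalf
  Hhalf_ler_normD Hhalf_normrZ Hhalf_normr0_eq0.

Lemma Hhalf_normE (z : Hhalf) : `|z| = `|sqrtA0 A (val z)|.
Proof. by []. Qed.

(* H_{-1/2}: the bounded conjugate-linear functionals on H_{1/2}, with the
   operator norm. The duality pairing <y, z> is the value y z. *)
Definition Hneg_pred : {pred Hhalf -> R[i]^o} := fun f => `[<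
  (forall (a : R[i]) u v, f (a *: u + v) = Num.conj a * f u + f v) /\
  exists M : R[i], forall z, `|f z| <= M * `|z| >].

Lemma Hneg_submod : submod_closed Hneg_pred.
Proof.
split.
  apply/asboolP; split; first by move=> a u v; rewrite mulr0 addr0.
  by exists 0 => z; rewrite normr0 mul0r.
move=> a f g /asboolP[fl [M fM]] /asboolP[gl [N gN]]; apply/asboolP; split.
  move=> b u v; rewrite /= !fctE fl gl /GRing.scale/=.
  by rewrite !mulrDr addrACA mulrCA.
exists (`|a| * M + N) => z; rewrite !fctE.
rewrite (le_trans (ler_normD _ _))// mulrDl lerD//.
by rewrite normrM -mulrA ler_wpM2l.
Qed.

HB.instance Definition _ :=
  GRing.isSubmodClosed.Build R[i] (Hhalf -> R[i]^o) Hneg_pred Hneg_submod.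

Record Hneg := MkHneg {
  Hneg_val :> Hhalf -> R[i]^o ; _ : Hneg_val \in Hneg_pred }.

HB.instance Definition _ := [isSub for Hneg_val].
HB.instance Definition _ := [Choice of Hneg by <:].
HB.instance Definition _ := [SubChoice_isSubLmodule of Hneg by <:].

Implicit Types (y f g : Hneg) (z : Hhalf).

Lemma Hneg_linear y (a : R[i]) u v : y (a *: u + v) = Num.conj a * y u + y v.
Proof. by have /asboolP[] := valP y. Qed.

Lemma Hneg_bounded y : exists2 M : R, 0 <= M &
  forall z, rnorm (y z : R[i]^o) <= M * rnorm z.
Proof.
have /asboolP[_ [M yM]] := valP y.
exists (rnorm (M : R[i]^o)) => [|z]; first exact: rnorm_ge0.
rewrite -lecR rmorphM/= -!rnormE; apply: (le_trans (yM z)).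
rewrite -[leLHS]ger0_norm ?(le_trans _ (yM z))//.
by rewrite normrM normr_id.
Qed.

Definition Hneg_norm y : R[i] :=
  (sup [set rnorm (y z : R[i]^o) | z in [set z | `|z| <= 1]])%:C.

Lemma Hneg_zero y : y 0 = 0.
Proof.
have := Hneg_linear y 1 0 0.
by rewrite scale1r addr0 rmorph1 mul1r => /eqP; rewrite -subr_eq subrr eq_sym
  => /eqP.
Qed.

Lemma Hneg_scale y (a : R[i]) z : y (a *: z) = Num.conj a * y z.
Proof. by rewrite -[a *: z]addr0 Hneg_linear Hneg_zero addr0. Qed.

Lemma Hneg_has_sup y :
  has_sup [set rnorm (y z : R[i]^o) | z in [set z | `|z| <= 1]].
Proof.
split; first by exists (rnorm (y 0 : R[i]^o)); exists 0 => //=; rewrite normr0.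
have [M M0 yM] := Hneg_bounded y.
exists M => _ [z z1 <-]; rewrite (le_trans (yM z))// ler_piMr//.
by rewrite -lecR -rnormE.
Qed.

Lemma Hneg_norm_ub y z : `|y z : R[i]^o| <= Hneg_norm y * `|z|.
Proof.
have [->|z0] := eqVneq z 0; first by rewrite Hneg_zero !normr0 mulr0.
have nz : 0 < `|z| by rewrite normr_gt0.
rewrite -ler_pdivrMr//.
have -> : `|y z : R[i]^o| / `|z| = `|y (`|z|^-1 *: z) : R[i]^o|.
  rewrite Hneg_scale normrM norm_conjC normfV normr_id mulrC.
  by [].
rewrite rnormE lecR; apply: sup_upper_bound; first exact: Hneg_has_sup.
by exists (`|z|^-1 *: z) => //=; rewrite normfZV.
Qed.

Lemma Hneg_norm_le y (M : R[i]) : 0 <= M ->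
  (forall z, `|y z : R[i]^o| <= M * `|z|) -> Hneg_norm y <= M.
Proof.
move=> M0 yM; rewrite -[M]RRe_real ?ger0_real// lecR.
apply: ge_sup; first by have [] := Hneg_has_sup y.
move=> _ [z z1 <-]; rewrite -lecR -rnormE RRe_real ?ger0_real//.
by rewrite (le_trans (yM z))// ler_piMr.
Qed.

Lemma Hneg_norm_ge0 y : 0 <= Hneg_norm y.
Proof.
rewrite lecR; apply: (le_trans (rnorm_ge0 (y 0 : R[i]^o))).
apply: sup_upper_bound; first exact: Hneg_has_sup.
by exists 0 => //=; rewrite normr0.
Qed.

Lemma Hneg_ler_normD f g : Hneg_norm (f + g) <= Hneg_norm f + Hneg_norm g.
Proof.
apply: Hneg_norm_le => [|z]; first by rewrite addr_ge0 ?Hneg_norm_ge0.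
rewrite mulrDl; apply: (le_trans (ler_normD (f z : R[i]^o) _)).
by rewrite lerD ?Hneg_norm_ub.
Qed.

Lemma Hneg_normrZ_le (a : R[i]) f : Hneg_norm (a *: f) <= `|a| * Hneg_norm f.
Proof.
apply: Hneg_norm_le => [|z]; first by rewrite mulr_ge0 ?Hneg_norm_ge0.
have -> : `|(a *: f) z : R[i]^o| = `|a| * `|f z : R[i]^o| by rewrite -normrM.
by rewrite -mulrA ler_wpM2l ?Hneg_norm_ub.
Qed.

Lemma Hneg_normrZ (a : R[i]) f : Hneg_norm (a *: f) = `|a| * Hneg_norm f.
Proof.
apply/eqP; rewrite eq_le Hneg_normrZ_le/=.
have [->|a0] := eqVneq a 0; first by rewrite normr0 mul0r Hneg_norm_ge0.
rewrite -ler_pdivlMl ?normr_gt0// -normfV.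
by apply: (le_trans _ (Hneg_normrZ_le _ _)); rewrite scalerK.
Qed.

Lemma Hneg_normr0_eq0 f : Hneg_norm f = 0 -> f = 0.
Proof.
move=> f0; apply: val_inj; apply/funext => z /=; apply/normr0_eq0/eqP.
by rewrite eq_le normr_ge0 andbT (le_trans (Hneg_norm_ub f z))// f0 mul0r.
Qed.

HB.instance Definition _ := Lmodule_isNormed.Build R[i] Hneg
  Hneg_ler_normD Hneg_normrZ Hneg_normr0_eq0.

Lemma embed_subproof (h : H) : (fun z => inner h (val z)) \in Hneg_pred.
Proof.
apply/asboolP; split=> [a u v|]; first by rewrite innerDr innerZr.
have [M M0 SM] := sqrtA0_bounded_below.
exists (`|h| * M) => z; apply: (le_trans (inner_cauchy_schwarz _ _)).
by rewrite -mulrA ler_wpM2l// SM//; exact: Hhalf_dom.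
Qed.

(* The embedding of H into H_{-1/2}. *)
Definition embed (h : H) : Hneg := MkHneg (embed_subproof h).

Lemma A0ext_subproof z :
  (fun v : Hhalf => inner (sqrtA0 A (val z)) (sqrtA0 A (val v))) \in Hneg_pred.
Proof.
apply/asboolP; split=> [a u v|].
  by rewrite sqrtA0_D sqrtA0_Z innerDr innerZr.
by exists `|z| => v; exact: inner_cauchy_schwarz.
Qed.

(* The extension of A_0 to a bounded operator from H_{1/2} to H_{-1/2}. *)
Definition A0ext z : Hneg := MkHneg (A0ext_subproof z).

Lemma A0ext_embed z : dom (A0 A) (val z) -> A0ext z = embed (A0 A (val z)).
Proof.
have [_ _ domE SS] := sqrtA0P A; move=> dz; rewrite SS//.
apply: val_inj; apply/funext => v /=.
move: dz; rewrite domE => -[dz dSz].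
by rewrite [RHS]sqrtA0_sym//; exact: Hhalf_dom.
Qed.

(* A_0^{-1/2} : H -> H_{1/2} *)
Definition sqrtA0inv (h : H) : Hhalf := xget 0 [set z | sqrtA0 A (val z) = h].

Lemma sqrtA0invK h : sqrtA0 A (val (sqrtA0inv h)) = h.
Proof.
have [y dy yh] := sqrtA0_surj h; rewrite /sqrtA0inv; case: xgetP => // /(_ _) none.
have yP : y \in Hhalf_pred by apply/asboolP.
by case: (none (MkHhalf yP)).
Qed.

(* The extension of A_0^{-1/2} to an operator from H_{-1/2} to H: the
   transpose of A_0^{-1/2} : H -> H_{1/2} under the two pairings. *)
Definition sqrtA0inv_ext y : H :=
  xget 0 [set u | forall h, inner u h = y (sqrtA0inv h)].

Lemma sqrtA0inv_ext_embed h : sqrtA0inv_ext (embed h) = val (sqrtA0inv h).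
Proof.
have sym k : inner (val (sqrtA0inv h)) k = embed h (sqrtA0inv k).
  rewrite /= -[in LHS](sqrtA0invK k) -sqrtA0_sym ?sqrtA0invK//; exact: Hhalf_dom.
rewrite /sqrtA0inv_ext; case: xgetP => [u _ uP|/(_ _ sym)//].
apply/eqP; rewrite -subr_eq0 -normr_eq0 -sqrf_eq0 -innerE.
by rewrite -scaleN1r innerDl innerZl uP sym mulN1r subrr.
Qed.

Lemma norm_embed h : `|embed h| = `|val (sqrtA0inv h)|.
Proof.
have e z : inner h (val z) = inner (val (sqrtA0inv h)) (sqrtA0 A (val z)).
  rewrite -[in LHS](sqrtA0invK h) sqrtA0_sym//; exact: Hhalf_dom.
apply/eqP; rewrite eq_le; apply/andP; split.
  apply: Hneg_norm_le => // z; rewrite /= e; exact: inner_cauchy_schwarz.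
have [->|u0] := eqVneq (val (sqrtA0inv h)) 0; first by rewrite normr0.
have := Hneg_norm_ub (embed h) (sqrtA0inv (val (sqrtA0inv h))).
rewrite /= e Hhalf_normE sqrtA0invK innerE expr2 normrM normr_id.
by rewrite ler_pM2r// normr_gt0.
Qed.

Lemma embed_inj : injective embed.
Proof.
move=> h k /(congr1 Hneg_val) hk; apply/eqP; rewrite -subr_eq0; apply/eqP.
have [[_ _ /(_ 0 (h - k))[+ _]] _ _ _] := sqrtA0P A.
case; last by rewrite sqrtA0_0.
move=> x dx; have xP : x \in Hhalf_pred by apply/asboolP.
rewrite inner0r innerC innerDl -scaleN1r innerZl.
have /= -> := congr1 (fun f : Hhalf -> R[i]^o => f (MkHhalf xP)) hk.
by rewrite mulN1r subrr rmorph0.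
Qed.

(* The element of H with image y in H_{-1/2}, when there is one. *)
Definition embed_inv y : H := xget 0 [set h | embed h = y].

Lemma embedK : cancel embed embed_inv.
Proof.
by move=> h; rewrite /embed_inv; case: xgetP => [k _ /embed_inj//|/(_ h)/(_ erefl)].
Qed.

Section Damping.
Variable D : {linear Hhalf -> Hneg}.

(* Points of H_{1/2} x H whose second component lies in H_{1/2} are seen in
   H_{1/2} x H_{1/2} through insubd. *)
Definition opA : operator (Hhalf * H)%type := Operator
  [set x | x.2 \in Hhalf_pred /\ range embed (A0ext x.1 + D (insubd 0 x.2))]
  (fun x => (insubd 0 x.2, - embed_inv (A0ext x.1 + D (insubd 0 x.2)))).

(* A_0^{-1/2} D A_0^{-1/2} *)
Definition sandwich (h : H) : H := sqrtA0inv_ext (D (sqrtA0inv h)).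

Definition rayleigh (z : Hhalf) : R := complex.Re (D z z).

(* When D is accretive these quotients are nonnegative, so that the real-valued
   [inf] is the infimum in Dbeta, Ddelta and Dmu as soon as H is nontrivial. *)
Definition Dbeta : R :=
  inf [set rayleigh z / rnorm (val z) ^+ 2 | z in [set z | z != 0]].

Definition Dgamma : \bar R := ereal_sup
  [set (rayleigh z / rnorm (val z) ^+ 2)%:E | z in [set z | z != 0]].

Definition Ddelta : R :=
  inf [set rayleigh z / rnorm z ^+ 2 | z in [set z | z != 0]].

Definition Dmu : R :=
  inf [set rayleigh z / (rnorm (val z) * rnorm z) | z in [set z | z != 0]].

End Damping.

End Hhalf.

Section Regions.
Context (R : realType).

Definition real_points (I : interval R) : set R[i] := [set x%:C | x in [set` I]].

Definition strip (I : interval R) : set R[i] :=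
  [set l | complex.Re l \in I].

Definition sector (m : R) : set R[i] :=
  [set l | `|complex.Im l| <= Num.sqrt (4 - m ^+ 2) / m * `|complex.Re l|].

Definition disc (d : R) : set R[i] :=
  [set l | `|l + (d^-1)%:C| <= (d^-1)%:C].

End Regions.

(* Main.v *)
From HB Require Import structures.
Require Import Defs.
From mathcomp Require Import all_boot all_order all_algebra.
From mathcomp Require Import all_classical all_reals all_analysis.
From mathcomp Require Import complex ring lra.
Set Implicit Arguments.
Unset Strict Implicit.
Unset Printing Implicit Defensive.
Import Order.TTheory GRing.Theory Num.Theory.
Import numFieldNormedType.Exports.
Local Open Scope classical_set_scope.
Local Open Scope ring_scope.

(** Conjugation by A_0^{-1/2} turns the equation (A - l) (z, w) = (f, g) into an
    equation in H for the quadratic pencil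
      L(l) = I + l S + l^2 A_0^{-1},   S = A_0^{-1/2} D A_0^{-1/2},
    so that l is in the resolvent set as soon as L(l) has a bounded inverse
    ([resolvent_opA]). Since S and A_0^{-1} are bounded and self-adjoint, the
    adjoint of L(l) is L(l^* ), and both are bounded below as soon as the
    quadratic form of L(l) is; by a Lax-Milgram argument ([coercive_inverse])
    L(l) is then invertible.

    At x = A_0^{1/2} z with z of norm 1 in H_{1/2}, the form of L(l) takes the
    value 1 + l s + l^2 k, where s = Re <D z, z> and k = |z|^2. These pairs
    (s, k) form a bounded subset of the plane, so by compactness a spectral
    point l satisfies 1 + l s + l^2 k = 0 for some (s, k) in the closure of that
    set ([spectrum_root]). The constants of the damping become the closed
    constraints
      b k <= s <= g k,   d <= s,   m^2 k <= s^2,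
    (the upper bound when g is finite), which survive in the closure
    ([damping_range_closure]). The enclosures of the spectrum are thus statements
    on the roots of one quadratic polynomial with real coefficients under these
    constraints. A nonreal root has real part
    - s / (2 k) and squared modulus 1 / k: the constraints translate one by one
    into a strip, a disc and a sector, the latter having no nonreal point when
    2 <= m. A real root is negative, at least -g, and outside of the gap cut out
    by the polynomial with the extreme values s / k = b and s = d. *)

(** * Roots of a quadratic polynomial with constrained coefficients *)

Lemma pencil_root_ReIm (R : realType) (l : R[i]) (s k : R) :
  1 + l * s%:C%C + l ^+ 2 * k%:C%C = 0 ->
  1 + s * complex.Re l + k * (complex.Re l ^+ 2 - complex.Im l ^+ 2) = 0 /\
  complex.Im l * (s + 2 * k * complex.Re l) = 0.
Proof.
case: l => x y /eqP; rewrite eq_complex /= => /andP[/eqP re /eqP im].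
by split; [rewrite -[RHS]re|rewrite -[RHS]im]; ring.
Qed.

Section Roots.
Context (R : realType) (x y s k : R).
Hypotheses (s0 : 0 <= s) (k0 : 0 <= k).
Hypothesis re0 : 1 + s * x + k * (x ^+ 2 - y ^+ 2) = 0.
Hypothesis im0 : y * (s + 2 * k * x) = 0.

(** A nonreal root comes with its conjugate: the sum of the two is [- s / k] and
    their product is [1 / k]. *)
Lemma nonreal_root : y != 0 ->
  [/\ 0 < k, s = - (2 * k * x) & k * (x ^+ 2 + y ^+ 2) = 1].
Proof.
move=> y0; have sE : s = - (2 * k * x).
  by move/eqP: im0; rewrite mulf_eq0 (negbTE y0) /= addr_eq0 => /eqP.
have kE : k * (x ^+ 2 + y ^+ 2) = 1.
  by apply/eqP; rewrite -subr_eq0 -oppr_eq0 -[X in _ == X]re0 sE; apply/eqP; ring.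
split=> //; rewrite lt_neqAle k0 andbT eq_sym; apply/eqP => k_eq0.
by move/eqP: kE; rewrite k_eq0 mul0r eq_sym oner_eq0.
Qed.

(** Only [s = 0] would allow purely imaginary roots; positivity of [m] rules it
    out. *)
Lemma root_Re_lt0 (m : R) : 0 < m -> m ^+ 2 * k <= s ^+ 2 -> x < 0.
Proof.
move=> m0 mks; have [y0|/nonreal_root[kp sE kE]] := eqVneq y 0.
  rewrite ltNge; apply/negP => x0; move: re0; rewrite y0.
  by have := mulr_ge0 s0 x0; have := mulr_ge0 k0 (sqr_ge0 x); nra.
rewrite ltNge; apply/negP => x0.
have s_eq0 : s = 0 by apply/eqP; rewrite eq_le s0 sE andbT; have := mulr_ge0 k0 x0; nra.
have : 0 < m ^+ 2 * k by rewrite mulr_gt0 ?exprn_gt0.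
by rewrite ltNge => /negP[]; rewrite (le_trans mks)// s_eq0 expr0n.
Qed.

(** A nonreal root would make the discriminant [s ^+ 2 - 4 * k] negative. *)
Lemma root_real (m : R) : 2 <= m -> m ^+ 2 * k <= s ^+ 2 -> y = 0.
Proof.
move=> m2 mks; apply/eqP; apply: contraT => /[dup] y0 /nonreal_root[kp sE kE].
have k2 : 0 < k ^+ 2 by rewrite exprn_gt0.
have y2 : 0 < y ^+ 2 by rewrite exprn_even_gt0.
have := mulr_gt0 k2 y2.
move: mks; rewrite sE => mks.
have : 4 * k <= m ^+ 2 * k by rewrite ler_wpM2r//; nra.
suff : k = k ^+ 2 * (x ^+ 2 + y ^+ 2) by nra.
by rewrite expr2 -mulrA kE mulr1.
Qed.

Lemma nonreal_root_le (b : R) : b * k <= s -> y != 0 -> x <= - (b / 2).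
Proof.
move=> bks /nonreal_root[kp sE _].
by rewrite -(ler_pM2l kp); move: bks; rewrite sE; nra.
Qed.

Lemma nonreal_root_ge (g : R) : s <= g * k -> y != 0 -> - (g / 2) <= x.
Proof.
move=> sgk /nonreal_root[kp sE _].
by rewrite -(ler_pM2l kp); move: sgk; rewrite sE; nra.
Qed.

Lemma nonreal_root_disc (d : R) :
  d <= s -> y != 0 -> d * (x ^+ 2 + y ^+ 2) + 2 * x <= 0.
Proof.
move=> ds /nonreal_root[kp sE kE].
rewrite -(ler_pM2l kp) mulr0 mulrDr mulrCA kE mulr1.
by move: ds; rewrite sE; nra.
Qed.

Lemma nonreal_root_sector (m : R) : m ^+ 2 * k <= s ^+ 2 -> y != 0 ->
  m ^+ 2 * y ^+ 2 <= (4 - m ^+ 2) * x ^+ 2.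
Proof.
move=> mks /nonreal_root[kp sE kE].
have : m ^+ 2 <= 4 * k * x ^+ 2.
  by rewrite -(ler_pM2l kp) mulrC (le_trans mks)// sE; apply/eqP/eqP; nra.
move=> /(ler_wpM2r (addr_ge0 (sqr_ge0 x) (sqr_ge0 y))).
have -> : 4 * k * x ^+ 2 * (x ^+ 2 + y ^+ 2) = 4 * x ^+ 2.
  by rewrite -[RHS]mulr1 -kE; ring.
by nra.
Qed.

Lemma root_ge (g : R) : s <= g * k -> x < 0 -> y = 0 -> - g <= x.
Proof.
move=> sgk x0 y0.
have [k_eq0|kp] : k = 0 \/ 0 < k by case: (ltgtP k 0) k0; [|right|left].
  have s_eq0 : s = 0 by apply/eqP; rewrite eq_le s0 (le_trans sgk)// k_eq0 mulr0.
  by move: re0; rewrite k_eq0 s_eq0; lra.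
rewrite leNgt; apply/negP => xg; move: re0; rewrite y0.
have kxs : k * x + s <= 0.
  by have : k * x < k * (- g); [rewrite ltr_pM2l|lra].
by have := mulr_le0 (ltW x0) kxs; nra.
Qed.

(** The polynomial in the conclusion is the extreme one, with [s / k = b] and
    [s = d]: [x] avoids the open interval between its roots. Indeed, dividing the
    equation by [s |x|] gives [1 = k/s |x| + 1/(s |x|) <= |x|/b + 1/(d |x|)]. *)
Lemma root_gap (b d : R) : 0 < b -> 0 < d -> b * k <= s -> d <= s ->
  x < 0 -> y = 0 -> 0 <= x ^+ 2 + b * x + b / d.
Proof.
move=> b0 d0 bks ds x0 y0; move: re0; rewrite y0 => eq0.
have sp : 0 < s by exact: lt_le_trans ds.
have -> : x ^+ 2 + b * x + b / d =
    ((s - b * k) * x ^+ 2 + b * (s / d - 1)) / s.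
  have sx : s * x = - 1 - k * x ^+ 2 by lra.
  apply: (@mulIf _ s); rewrite ?divfK ?gt_eqF//.
  have -> : (x ^+ 2 + b * x + b / d) * s =
      s * x ^+ 2 + b * (s * x) + b * (s / d) by ring.
  by rewrite sx; ring.
apply: divr_ge0; rewrite ?(ltW sp)// addr_ge0// mulr_ge0 ?sqr_ge0 ?subr_ge0// ?(ltW b0)//.
by rewrite ler_pdivlMr// mul1r.
Qed.

End Roots.

(** * Contractions and bounded maps *)

Section RealNorm.
Context (R : realType) (V : normedModType R[i]).
Implicit Types (x y : V) (a : R[i]).

Lemma rnormD x y : rnorm (x + y) <= rnorm x + rnorm y.
Proof. by rewrite -lecR rmorphD/= -!rnormE ler_normD. Qed.

Lemma rnormN x : rnorm (- x) = rnorm x.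
Proof. by rewrite /rnorm normrN. Qed.

Lemma rnormB x y : rnorm (x - y) = rnorm (y - x).
Proof. by rewrite /rnorm distrC. Qed.

Lemma rnormZ a x : rnorm (a *: x) = rnorm (a : R[i]^o) * rnorm x.
Proof. by apply: complexI; rewrite rmorphM/= -!rnormE normrZ. Qed.

Lemma rnorm0_eq0 x : rnorm x = 0 -> x = 0.
Proof. by move=> x0; apply/normr0_eq0; rewrite rnormE x0. Qed.

Lemma rnorm_gt0 x : x != 0 -> 0 < rnorm x.
Proof. by move=> x0; rewrite -ltcR -rnormE normr_gt0. Qed.

Lemma rnorm_real (t : R) : rnorm (t%:C%C : R[i]^o) = `|t|.
Proof. by rewrite /rnorm normc_def/= expr0n addr0 sqrtr_sqr. Qed.

End RealNorm.

(** Two points are no further apart than [1 / (1 - q)] times the sum of their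
    displacements under [f]. The displacements of the iterates decay
    geometrically, hence the iterates form a Cauchy sequence. *)
Lemma contraction_fixed_point (R : realType) (V : completeNormedModType R[i])
    (f : V -> V) (q : R) : 0 <= q < 1 ->
  (forall x y, rnorm (f x - f y) <= q * rnorm (x - y)) -> exists p, f p = p.
Proof.
move=> /andP[q0 q1] fq.
have q1' : 0 < 1 - q by rewrite subr_gt0.
pose u n := iter n f 0; pose C := rnorm (u 0 - f (u 0)).
have uf n : rnorm (u n - f (u n)) <= C * q ^+ n.
  elim: n => [|n IH]; first by rewrite mulr1.
  by rewrite exprS mulrCA (le_trans (fq _ _))// ler_wpM2l.
have uu x y : (1 - q) * rnorm (x - y) <= rnorm (x - f x) + rnorm (y - f y).
  have -> : x - y = (x - f x) + (f x - f y) + (f y - y).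
    by rewrite -!addrA !addKr.
  set w := _ + _ + _; have wE : w = x - y by rewrite /w -!addrA !addKr.
  have := rnormD (x - f x + (f x - f y)) (f y - y).
  have := rnormD (x - f x) (f x - f y).
  have := fq x y; rewrite -/w wE [rnorm (f y - y)]rnormB; lra.
have Cq : (C * q ^+ n)%R @[n --> \oo] --> (0 : R).
  by rewrite -[X in _ --> X](mulr0 C); apply: cvgMr; apply: cvg_expr; rewrite ger0_norm.
have cu : cvg (u n @[n --> \oo]).
  apply/cauchy_cvgP/cauchy_exP => e e0.
  have eE : e = (complex.Re e)%:C%C by rewrite RRe_real// gtr0_real.
  have e1 : 0 < (1 - q) * (complex.Re e / 2).
    by rewrite mulr_gt0// divr_gt0// -ltcR -eE.
  have [N _ NC] := (@cvgr_lt _ _ _ _ _ _ Cq _ e1).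
  exists (u N); exists N => // n Nn.
  rewrite -ball_normE /ball_/= eE rnormE ltcR.
  rewrite -(ltr_pM2l q1') (le_lt_trans (uu _ _))//.
  have := NC N (leqnn N); have := NC n Nn; have := uf N; have := uf n => /=.
  lra.
pose p := lim (u n @[n --> \oo]).
exists p; apply/eqP; rewrite eq_sym -subr_eq0; apply: contraT => pf.
have e0 := rnorm_gt0 pf; set e := rnorm _ in e0.
have e4 : 0 < e / 4 by rewrite divr_gt0.
have [N1 _ NC] := (@cvgr_lt _ _ _ _ _ _ Cq _ e4).
have e4c : 0 < (e / 4)%:C%C by rewrite ltcR.
have [N2 _ Np] := (@cvgr_dist_lt _ _ _ _ _ _ _ cu _ e4c).
pose N := maxn N1 N2.
have := NC N (leq_maxl _ _); have := Np N (leq_maxr _ _) => /=; rewrite rnormE ltcR -/p.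
have := uf N; have := fq (u N) p; rewrite [rnorm (u N - p)]rnormB.
have := rnormD (p - u N + (u N - f (u N))) (f (u N) - f p).
have := rnormD (p - u N) (u N - f (u N)).
have -> : p - u N + (u N - f (u N)) + (f (u N) - f p) = p - f p.
  by rewrite -!addrA !addKr.
rewrite -/e; have := rnorm_ge0 (p - u N); nra.
Qed.

(** The bound is between real-valued norms, so that operator bounds live in the
    totally ordered field [R] rather than in [R[i]]. *)
Definition bounded_map (R : realType) (V W : normedModType R[i]) (f : V -> W) :=
  exists2 M : R, 0 <= M & forall x, rnorm (f x) <= M * rnorm x.

Section BoundedMaps.
Context (R : realType).
Implicit Types U V W : normedModType R[i].

Lemma bounded_mapP V W (f : {linear V -> W}) : bounded_map f <-> continuous f.
Proof.
rewrite -linear_bounded_continuous; split=> [[M M0 fM]|].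
  apply/linear_boundedP; near=> r => x.
  rewrite !rnormE (@le_trans _ _ (M%:C%C * (rnorm x)%:C%C))//.
    by rewrite -rmorphM lecR.
  rewrite ler_wpM2r ?lecR ?rnorm_ge0//; near: r.
  by apply: nbhs_pinfty_ge; apply/complex_realP; exists M.
move=> /linear_boundedP/pinfty_ex_gt0[M M0 fM]; exists (complex.Re M).
  by rewrite -lecR RRe_real ?gtr0_real ?ltW.
by move=> x; rewrite -lecR rmorphM/= -!rnormE RRe_real ?gtr0_real.
Unshelve. all: by end_near. Qed.

Lemma bounded_map_comp U V W (f : V -> W) (g : U -> V) :
  bounded_map f -> bounded_map g -> bounded_map (f \o g).
Proof.
move=> [M M0 fM] [N N0 gN]; exists (M * N) => [|x]; first exact: mulr_ge0.
by rewrite (le_trans (fM _))// -mulrA ler_wpM2l.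
Qed.

Lemma bounded_mapD V W (f g : V -> W) :
  bounded_map f -> bounded_map g -> bounded_map (fun x => f x + g x).
Proof.
move=> [M M0 fM] [N N0 gN]; exists (M + N) => [|x]; first exact: addr_ge0.
by rewrite (le_trans (rnormD _ _))// mulrDl lerD.
Qed.

Lemma bounded_mapN V W (f : V -> W) :
  bounded_map f -> bounded_map (fun x => - f x).
Proof. by move=> [M M0 fM]; exists M => // x; rewrite rnormN. Qed.

Lemma bounded_mapZ V W (a : R[i]) (f : V -> W) :
  bounded_map f -> bounded_map (fun x => a *: f x).
Proof.
move=> [M M0 fM]; exists (rnorm (a : R[i]^o) * M) => [|x].
  by rewrite mulr_ge0 ?rnorm_ge0.
by rewrite rnormZ -mulrA ler_wpM2l ?rnorm_ge0.
Qed.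

Lemma bounded_map_id V : bounded_map (@id V).
Proof. by exists 1 => // x; rewrite mul1r. Qed.

Lemma rnorm_pair V W (p : V * W) : rnorm p = Num.max (rnorm p.1) (rnorm p.2).
Proof.
apply: complexI; rewrite -rnormE prod_normE !rnormE /Order.max/= ltcR.
by case: ifP.
Qed.

Lemma bounded_map_pair U V W (f : U -> V) (g : U -> W) :
  bounded_map f -> bounded_map g -> bounded_map (fun x => (f x, g x)).
Proof.
move=> [M M0 fM] [N N0 gN]; exists (M + N) => [|x]; first exact: addr_ge0.
rewrite rnorm_pair ge_max/= mulrDl.
rewrite (le_trans (fM x)) ?lerDl ?mulr_ge0 ?rnorm_ge0//=.
by rewrite (le_trans (gN x)) ?lerDr ?mulr_ge0 ?rnorm_ge0.
Qed.

Lemma bounded_map_fst V W : bounded_map (@fst V W).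
Proof.
exists 1 => // -[x y]; rewrite mul1r rnorm_pair/=.
by rewrite le_max lexx.
Qed.

Lemma bounded_map_snd V W : bounded_map (@snd V W).
Proof.
exists 1 => // -[x y]; rewrite mul1r rnorm_pair/=.
by rewrite le_max lexx orbT.
Qed.

End BoundedMaps.

(** * Inversion of coercive operators *)

Section Hilbert.
Context (R : realType) (H : hilbertType R).
Implicit Types x y : H.

Lemma innerNl x y : inner (- x) y = - inner x y.
Proof. by rewrite -scaleN1r innerZl mulN1r. Qed.

Lemma innerBl x y z : inner (x - y) z = inner x z - inner y z.
Proof. by rewrite innerDl innerNl. Qed.

Lemma inner_eq (x y : H) : (forall z, inner x z = inner y z) -> x = y.
Proof.
move=> xy; apply/eqP; rewrite -subr_eq0 -normr_eq0 -sqrf_eq0 -innerE.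
by rewrite innerBl xy subrr.
Qed.

Lemma rnorm_inner_le x y : rnorm (inner x y : R[i]^o) <= rnorm x * rnorm y.
Proof. by rewrite -lecR rmorphM/= -!rnormE inner_cauchy_schwarz. Qed.

Lemma rnorm_sqr x : rnorm x ^+ 2 = complex.Re (inner x x).
Proof. by rewrite innerE rnormE -rmorphXn. Qed.

Lemma rnorm_sqrB x y :
  rnorm (x - y) ^+ 2 = rnorm x ^+ 2 - 2 * complex.Re (inner x y) + rnorm y ^+ 2.
Proof.
have Re_inner : complex.Re (inner y x) = complex.Re (inner x y).
  by rewrite innerC; case: (inner x y).
rewrite !rnorm_sqr innerBl -scaleN1r !innerDr !innerZr rmorphN1 !mulN1r.
move: Re_inner.
move: (inner x x) (inner x y) (inner y x) (inner y y).
by move=> [a ?] [b ?] [b' ?] [c ?] /= ->; ring.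
Qed.

(** Lax-Milgram, with the adjoint given. Coercivity bounds both [T] and [T'] from
    below. A solution of [T x = y] is a fixed point of
    [x |-> x - t T' (T x - y)], by injectivity of [T'], and this map is a
    contraction for small [t] because
    [|h - t T' T h|^2 = |h|^2 - 2 t |T h|^2 + t^2 |T' T h|^2]. *)
Lemma coercive_inverse (T T' : {linear H -> H}) (c : R) :
  bounded_map T -> bounded_map T' ->
  (forall x y, inner (T x) y = inner x (T' y)) -> 0 < c ->
  (forall x, c * rnorm x ^+ 2 <= rnorm (inner (T x) x : R[i]^o)) ->
  exists G : {linear H -> H},
    [/\ bounded_map G, cancel G T & cancel T G].
Proof.
move=> [M0 M00 TM0] [M1 M10 TM1] adj c0 coer.
(* The summand c ensures c <= M, which makes the ratio q nonnegative. *)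
pose M := M0 + M1 + c.
have Mp : 0 < M by rewrite /M; lra.
have TM x : rnorm (T x) <= M * rnorm x.
  by rewrite (le_trans (TM0 x))// ler_wpM2r ?rnorm_ge0// /M; lra.
have T'M x : rnorm (T' x) <= M * rnorm x.
  by rewrite (le_trans (TM1 x))// ler_wpM2r ?rnorm_ge0// /M; lra.
have below (S : H -> H) x : c * rnorm x ^+ 2 <= rnorm (inner (S x) x : R[i]^o) ->
    c * rnorm x <= rnorm (S x).
  move=> cS; have [->|x0] := eqVneq (rnorm x) 0; first by rewrite mulr0 rnorm_ge0.
  have xp : 0 < rnorm x by rewrite lt_neqAle eq_sym x0 rnorm_ge0.
  by rewrite -(ler_pM2r xp) -mulrA -expr2 (le_trans cS)// rnorm_inner_le.
have Tc x : c * rnorm x <= rnorm (T x) by exact: below.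
have T'c x : c * rnorm x <= rnorm (T' x).
  by apply: below; rewrite innerC -adj /rnorm norm_conjC; exact: coer.
have inj (S : {linear H -> H}) : (forall x, c * rnorm x <= rnorm (S x)) ->
    injective S.
  move=> Sc x y Sxy; apply/eqP; rewrite -subr_eq0; apply/eqP/rnorm0_eq0.
  have := Sc (x - y); rewrite linearB Sxy subrr [rnorm 0]/rnorm normr0/=.
  by rewrite pmulr_rle0// => h; apply/eqP; rewrite eq_le h rnorm_ge0.
(* This t minimizes 1 - 2 t c^2 + t^2 M^4, and q is the minimum. *)
pose t := c ^+ 2 / M ^+ 4; pose q := 1 - c ^+ 4 / M ^+ 4.
have tp : 0 < t by rewrite divr_gt0 ?exprn_gt0.
have q01 : 0 <= q < 1.
  have cM : c ^+ 4 <= M ^+ 4.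
    have cM1 : c <= M by rewrite /M; lra.
    by rewrite lerXn2r ?nnegrE// ltW.
  have : c ^+ 4 / M ^+ 4 <= 1 by rewrite ler_pdivrMr ?mul1r// exprn_gt0.
  have : 0 < c ^+ 4 / M ^+ 4 by rewrite divr_gt0 ?exprn_gt0.
  by rewrite /q; set w := _ / _; lra.
have step x : rnorm (x - t%:C%C *: T' (T x)) ^+ 2 <= q * rnorm x ^+ 2.
  rewrite rnorm_sqrB innerZr conj_Creal; last by apply/complex_realP; exists t.
  rewrite -adj rnormZ rnorm_real (gtr0_norm tp).
  have -> : complex.Re (t%:C%C * inner (T x) (T x)) = t * rnorm (T x) ^+ 2.
    by rewrite innerE rnormE -rmorphXn -rmorphM.
  have a1 : c ^+ 2 * rnorm x ^+ 2 <= rnorm (T x) ^+ 2.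
    by rewrite -exprMn lerXn2r ?nnegrE ?mulr_ge0 ?rnorm_ge0 ?(ltW c0).
  have a2 : rnorm (T' (T x)) ^+ 2 <= M ^+ 4 * rnorm x ^+ 2.
    have -> : M ^+ 4 * rnorm x ^+ 2 = (M * (M * rnorm x)) ^+ 2 by ring.
    rewrite lerXn2r ?nnegrE ?mulr_ge0 ?rnorm_ge0 ?(ltW Mp)//.
    by rewrite (le_trans (T'M _))// ler_wpM2l ?(ltW Mp).
  rewrite exprMn.
  have := ler_wpM2l (ltW tp) a1; have := ler_wpM2l (sqr_ge0 t) a2.
  have e1 : t ^+ 2 * (M ^+ 4 * rnorm x ^+ 2) = c ^+ 4 / M ^+ 4 * rnorm x ^+ 2.
    by rewrite /t; field; rewrite gt_eqF.
  have e2 : t * (c ^+ 2 * rnorm x ^+ 2) = c ^+ 4 / M ^+ 4 * rnorm x ^+ 2.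
    by rewrite /t; field; rewrite gt_eqF.
  rewrite e1 e2 /q mulrBl mul1r; set w := _ / _ * _; lra.
have surj y : exists x, T x = y.
  have /andP[q0 q1] := q01.
  pose f x := x - t%:C%C *: T' (T x - y).
  have [||p fp] := @contraction_fixed_point R H f (Num.sqrt q).
  - by rewrite sqrtr_ge0/= -sqrtr1 ltr_sqrt.
  - move=> x1 x2; rewrite -(ler_pXn2r (n := 2)) ?nnegrE ?mulr_ge0 ?sqrtr_ge0 ?rnorm_ge0//.
    rewrite exprMn sqr_sqrtr//.
    have -> : f x1 - f x2 = (x1 - x2) - t%:C%C *: T' (T (x1 - x2)).
      have e (a b c' d : H) : a - b - (c' - d) = a - c' - (b - d).
        by rewrite !opprD !opprK !addrA (addrAC a).
      rewrite /f e -scalerBr -linearB /= [in RHS]linearB.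
      by congr (_ - _ *: T' _); rewrite opprB addrA subrK.
    exact: step.
  exists p; apply/eqP; rewrite -subr_eq0; apply/eqP/(inj _ T'c).
  rewrite linear0; move/eqP: fp; rewrite /f -subr_eq0 addrAC subrr sub0r oppr_eq0.
  by rewrite scaler_eq0 [_ == 0 :> R[i]]gt_eqF ?ltcR//= => /eqP.
have [g gT] := choice surj.
have gl : linear g.
  by move=> a x y; apply: (inj _ Tc); rewrite linearP/= !gT.
pose G : {linear H -> H} := HB.pack g (GRing.isLinear.Build _ _ _ _ g gl).
exists G; split=> [|//|x].
  exists c^-1 => [|x]; first by rewrite invr_ge0 ltW.
  by rewrite ler_pdivlMl// -{2}[x]gT; exact: Tc.
by apply: (inj _ Tc); rewrite gT.
Qed.

End Hilbert.

Lemma bounded_eq0_dense (R : realType) (V W : normedModType R[i])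
    (f : {linear V -> W}) (E : set V) :
  bounded_map f -> dense E -> (forall x, E x -> f x = 0) -> forall x, f x = 0.
Proof.
move=> [M M0 fM] dE fE x; apply/eqP; apply: contraT => fx.
have e0 := rnorm_gt0 fx; set e := rnorm (f x) in e0.
have M1 : 0 < M + 1 by lra.
have r0 : 0 < e / (M + 1) by rewrite divr_gt0.
have rC : 0 < (e / (M + 1))%:C%C by rewrite ltcR.
have [||y [xy Ey]] := dE (ball x (e / (M + 1))%:C%C); first by exists x; exact: ballxx.
  exact: ball_open.
move: xy; rewrite -ball_normE /= rnormE ltcR ltr_pdivlMr//.
have := fM (x - y); rewrite linearB (fE y Ey) subr0 -/e.
by have := rnorm_ge0 (x - y); nra.
Qed.

(** * The spaces H_{1/2} and H_{-1/2} seen from H *)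

Section HalfSpace.
Context (R : realType) (H : hilbertType R) (A : positive_operator H).

(** The isometry A_0^{1/2} from H_{1/2} onto H, with inverse [sqrtA0inv A]. *)
Definition sqrtA0half (z : Hhalf A) : H := sqrtA0 A (val z).

Lemma sqrtA0half_linear : linear sqrtA0half.
Proof. by move=> a x y; rewrite /sqrtA0half sqrtA0_D sqrtA0_Z. Qed.

HB.instance Definition _ :=
  GRing.isLinear.Build R[i] (Hhalf A) H *:%R sqrtA0half sqrtA0half_linear.

Lemma rnorm_sqrtA0half z : rnorm (sqrtA0half z) = rnorm z.
Proof. by []. Qed.

Lemma sqrtA0half_inj : injective sqrtA0half.
Proof.
move=> x y xy; apply/eqP; rewrite -subr_eq0; apply/eqP/rnorm0_eq0.
by rewrite -rnorm_sqrtA0half linearB/= xy subrr /rnorm normr0.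
Qed.

Lemma sqrtA0inv_half : cancel (sqrtA0inv A) sqrtA0half.
Proof. exact: sqrtA0invK. Qed.

Lemma sqrtA0half_inv : cancel sqrtA0half (sqrtA0inv A).
Proof. by move=> z; apply: sqrtA0half_inj; rewrite sqrtA0inv_half. Qed.

Lemma sqrtA0inv_linear : linear (sqrtA0inv A).
Proof.
by move=> a x y; apply: sqrtA0half_inj; rewrite linearP/= !sqrtA0inv_half.
Qed.

HB.instance Definition _ :=
  GRing.isLinear.Build R[i] H (Hhalf A) *:%R (sqrtA0inv A) sqrtA0inv_linear.

Lemma bounded_val : bounded_map (val : Hhalf A -> H).
Proof.
have [M M0 vM] := sqrtA0_bounded_below A; exists (complex.Re M) => [|z].
  by rewrite -lecR RRe_real ?ger0_real.
rewrite -lecR rmorphM/= -!rnormE RRe_real ?ger0_real//.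
exact/vM/Hhalf_dom.
Qed.

Lemma bounded_sqrtA0half : bounded_map sqrtA0half.
Proof. by exists 1 => // z; rewrite mul1r rnorm_sqrtA0half. Qed.

Lemma bounded_sqrtA0inv : bounded_map (sqrtA0inv A).
Proof.
by exists 1 => // h; rewrite mul1r -{2}[h]sqrtA0inv_half rnorm_sqrtA0half.
Qed.

Definition invsqrtA0 (h : H) : H := val (sqrtA0inv A h).

Lemma invsqrtA0_linear : linear invsqrtA0.
Proof. by move=> a x y; rewrite /invsqrtA0 !linearP. Qed.

HB.instance Definition _ :=
  GRing.isLinear.Build R[i] H H *:%R invsqrtA0 invsqrtA0_linear.

Lemma bounded_invsqrtA0 : bounded_map invsqrtA0.
Proof. exact: bounded_map_comp bounded_val bounded_sqrtA0inv. Qed.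

Lemma inner_invsqrtA0 h (z : Hhalf A) :
  inner (invsqrtA0 h) (sqrtA0half z) = inner h (val z).
Proof.
rewrite -[in RHS](sqrtA0inv_half h) /sqrtA0half sqrtA0_sym//; exact: Hhalf_dom.
Qed.

Lemma invsqrtA0_sym h k : inner (invsqrtA0 h) k = inner h (invsqrtA0 k).
Proof. by rewrite -inner_invsqrtA0 sqrtA0inv_half. Qed.

Context (D : {linear Hhalf A -> Hneg A}).

(** If [h] is in the domain of A_0^{1/2} then A_0^{-1/2} [h] is in H_1, which [D]
    maps into H, and the identity is the symmetry of A_0^{-1/2}. Both sides being
    bounded, it extends to H because that domain is dense. *)
Lemma sandwich_form : continuous D ->
  (forall z : Hhalf A, dom (A0 A) (val z) -> range (embed A) (D z)) ->
  bounded_selfadjoint (sandwich D) ->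
  forall h k, inner (sandwich D h) k = D (sqrtA0inv A h) (sqrtA0inv A k).
Proof.
move=> /bounded_mapP[M M0 DM] D1 [[[_ Sl] _ _] Sc] h k.
have Slin : linear (sandwich D) by move=> a x y; have [] := Sl a x y I I.
pose S : {linear H -> H} :=
  HB.pack (sandwich D) (GRing.isLinear.Build _ _ _ _ _ Slin).
pose f (x : H) : R[i]^o := inner (S x) k - D (sqrtA0inv A x) (sqrtA0inv A k).
have fl : linear f.
  move=> a x y; rewrite /f.
  have -> : D (sqrtA0inv A (a *: x + y)) (sqrtA0inv A k) =
    a * D (sqrtA0inv A x) (sqrtA0inv A k) + D (sqrtA0inv A y) (sqrtA0inv A k).
    by rewrite !linearP.
  by rewrite linearP innerDl innerZl [in RHS]/GRing.scale/= mulrBr opprD addrACA.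
pose F : {linear H -> R[i]^o} :=
  HB.pack f (GRing.isLinear.Build _ _ _ _ _ fl).
suff /eqP : F h = 0 by rewrite subr_eq0 => /eqP.
have [sl dense_sqrt _] : selfadjoint (sqrtA0 A) by case: (sqrtA0P A).
apply: bounded_eq0_dense dense_sqrt _ h => [|x dx].
  have /bounded_mapP[N N0 SN] : continuous S by [].
  exists ((N + M) * rnorm k) => [|x].
    by rewrite mulr_ge0 ?addr_ge0 ?rnorm_ge0.
  apply: (le_trans (rnormD _ _)); rewrite rnormN mulrAC !mulrDl lerD//.
    by rewrite (le_trans (rnorm_inner_le _ _))// ler_wpM2r ?rnorm_ge0.
  have := Hneg_norm_ub (D (sqrtA0inv A x)) (sqrtA0inv A k).
  rewrite -/(Num.norm _) !rnormE -rmorphM lecR => /le_trans; apply.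
  rewrite -rnorm_sqrtA0half sqrtA0inv_half ler_wpM2r ?rnorm_ge0//.
  by rewrite (le_trans (DM _))// -rnorm_sqrtA0half sqrtA0inv_half.
have domx : dom (A0 A) (val (sqrtA0inv A x)).
  have [_ _ -> _] := sqrtA0P A; split; first exact: Hhalf_dom.
  by rewrite -/(sqrtA0half _) sqrtA0inv_half.
have [y _ Dy] := D1 _ domx.
rewrite /F/= /f/= /sandwich -Dy sqrtA0inv_ext_embed.
by rewrite -/(invsqrtA0 _) invsqrtA0_sym subrr.
Qed.

(** * The quadratic pencil and the resolvent *)

Variable S : {linear H -> H}.
Hypothesis S_form :
  forall h k, inner (S h) k = D (sqrtA0inv A h) (sqrtA0inv A k).

Local Notation P := invsqrtA0.

(** With [S] the operator A_0^{-1/2} [D] A_0^{-1/2}, this is [l ^+ 2 + l D + A_0]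
    multiplied on both sides by A_0^{-1/2}; [P (P h)] is A_0^{-1} [h]. *)
Definition pencil (l : R[i]) (h : H) : H :=
  h + l *: S h + l ^+ 2 *: P (P h).

Lemma pencil_linear l : linear (pencil l).
Proof.
move=> a x y; rewrite /pencil !linearP/= !scalerDr.
by rewrite [LHS](AC ((2*2)*2) (((1*3)*5)*((2*4)*6)))/=.
Qed.

HB.instance Definition _ l :=
  GRing.isLinear.Build R[i] H H *:%R (pencil l) (pencil_linear l).

Lemma bounded_pencil l : bounded_map S -> bounded_map (pencil l).
Proof.
move=> bS; apply: bounded_mapD; first apply: bounded_mapD.
- exact: bounded_map_id.
- exact: bounded_mapZ.
- exact/bounded_mapZ/(bounded_map_comp bounded_invsqrtA0 bounded_invsqrtA0).
Qed.

(** The equation of H_{-1/2} on the left becomes one of H under the isometry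
    A_0^{-1/2}; testing against A_0^{1/2} [v] undoes it. *)
Lemma damped_embedE (z w : Hhalf A) (h : H) :
  A0ext z + D w = embed A h <->
  sqrtA0half z + S (sqrtA0half w) = P h.
Proof.
have e v : (A0ext z + D w) v =
    inner (sqrtA0half z + S (sqrtA0half w)) (sqrtA0half v).
  by rewrite innerDl S_form !sqrtA0half_inv.
split=> [E|E].
  apply: inner_eq => k; rewrite -[k]sqrtA0inv_half -e E.
  by rewrite inner_invsqrtA0.
apply: val_inj; apply/funext => v /=.
by have /= -> := e v; rewrite E inner_invsqrtA0.
Qed.

(** Elimination of the second unknown in [(opA D - l) (z, w) = (f, g)]: the first
    row gives [w = f + l z], the second one is then an equation for
    [u] = A_0^{1/2} [z]. *)
Lemma damped_resolventE (l : R[i]) (u : H) (f : Hhalf A) (g : H) :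
  let w := f + l *: sqrtA0inv A u in
  A0ext (sqrtA0inv A u) + D w = embed A (- g - l *: val w) <->
  pencil l u = - (P g + S (sqrtA0half f) + l *: P (val f)).
Proof.
move=> w; apply: (iff_trans (damped_embedE _ _ _)); rewrite sqrtA0inv_half.
have -> : S (sqrtA0half w) = S (sqrtA0half f) + l *: S u.
  have -> : sqrtA0half w = sqrtA0half f + l *: u.
    by rewrite /w addrC linearP/= sqrtA0inv_half addrC.
  by rewrite linearD linearZ.
have -> : P (- g - l *: val w) =
    - P g - (l *: P (val f) + l ^+ 2 *: P (P u)).
  have -> : val w = val f + l *: P u by rewrite /w addrC linearP addrC.
  rewrite linearB linearN; congr (_ - _).
  by rewrite scalerDr scalerA linearD !linearZ.
rewrite /pencil.
move: (l *: S u) (_ *: P (P u)) (P g) (S _) (l *: P _) => b c p s q.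
split=> /eqP; rewrite -subr_eq0 !opprD !opprK => /eqP e;
  apply/eqP; rewrite -subr_eq0 !opprD !opprK -[X in _ == X]e; apply/eqP.
  by rewrite [RHS](AC ((1*2)*(1*2)) ((1*3*6)*(4*2*5)))/=.
by rewrite [RHS](AC (3*3) ((1*(5*2))*(4*(6*3))))/=.
Qed.

Lemma resolvent_opA (l : R[i]) (G : {linear H -> H}) :
  bounded_map S -> bounded_map G ->
  cancel G (pencil l) -> cancel (pencil l) G -> resolvent_set (opA D) l.
Proof.
move=> bS bG GK KG.
(* For the right-hand side x, u x is A_0^{1/2} of the first component of the
   solution and w x is the second one, before its inclusion in H. *)
pose r (x : Hhalf A * H) : H := P x.2 + S (sqrtA0half x.1) + l *: P (val x.1).
pose u x : H := - G (r x).
pose w x : Hhalf A := x.1 + l *: sqrtA0inv A (u x).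
pose B x : Hhalf A * H := (sqrtA0inv A (u x), val (w x)).
have Lu x : pencil l (u x) = - r x.
  by rewrite -[RHS]GK [G (- _)]linearN.
have ul : linear u.
  move=> a x y; rewrite /u.
  have -> : r (a *: x + y) = a *: r x + r y.
    rewrite /r !linearP/= !scalerDr.
    by rewrite [LHS](AC ((2*2)*2) (((1*3)*5)*((2*4)*6)))/=.
  by rewrite linearP opprD -scalerN.
have wl : linear w.
  move=> a x y; rewrite /w ul !linearP/= !scalerDr.
  by rewrite [LHS](AC (2*2) ((1*3)*(2*4)))/=.
have Bl : linear B.
  by move=> a x y; rewrite /B ul wl !linearP.
pose BL : {linear (Hhalf A * H)%type -> (Hhalf A * H)%type} :=
  HB.pack B (GRing.isLinear.Build _ _ _ _ _ Bl).
have bu : bounded_map u.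
  have bfst := @bounded_map_fst R (Hhalf A) H.
  apply/bounded_mapN/(bounded_map_comp bG)/bounded_mapD; first apply: bounded_mapD.
  - exact: bounded_map_comp bounded_invsqrtA0 (@bounded_map_snd _ _ _).
  - exact: bounded_map_comp bS (bounded_map_comp bounded_sqrtA0half bfst).
  - apply/bounded_mapZ/(bounded_map_comp bounded_invsqrtA0).
    exact: bounded_map_comp bounded_val bfst.
have solves x :
    A0ext (sqrtA0inv A (u x)) + D (w x) = embed A (- x.2 - l *: val (w x)).
  exact/damped_resolventE.
exists BL; split.
- apply/bounded_mapP/bounded_map_pair.
    exact: bounded_map_comp bounded_sqrtA0inv bu.
  apply: (bounded_map_comp bounded_val); apply: bounded_mapD.
    exact: bounded_map_fst.
  exact/bounded_mapZ/(bounded_map_comp bounded_sqrtA0inv bu).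
- move=> [f g]; set x := (f, g).
  have wE : insubd 0 (val (w x)) = w x by rewrite valKd.
  split.
    split=> /=; first exact: (valP (w x)).
    by exists (- g - l *: val (w x)) => //; rewrite wE solves.
  rewrite /= wE solves embedK.
  congr (_, _); first by rewrite /= /w addrK.
  rewrite -[LHS]/(- (- g - l *: val (w x)) - l *: val (w x)).
  by rewrite opprB opprK addrAC subrr add0r.
- move=> [z x2] [/= x2P [h _ hE]].
  rewrite -hE embedK; move: hE; set w0 := insubd 0 x2 => hE.
  have w0E : val w0 = x2 by rewrite insubdK.
  pose x := (w0 - l *: z, - h - l *: x2).
  have uE : u x = sqrtA0half z.
    apply: (can_inj KG); rewrite Lu; apply/esym/damped_resolventE.
    by rewrite sqrtA0half_inv subrK w0E opprB opprK addrAC subrr add0r hE.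
  rewrite -[LHS]/(B x) /B /w uE sqrtA0half_inv /x/= subrK.
  by rewrite w0E.
Qed.

Hypothesis S_sym : forall x y, inner (S x) y = inner x (S y).

(** As S and A_0^{-1} are symmetric, only the scalars get conjugated. *)
Lemma pencil_adjoint l x y :
  inner (pencil l x) y = inner x (pencil (Num.conj l) y).
Proof.
rewrite /pencil !innerDl !innerDr !innerZl !innerZr S_sym !invsqrtA0_sym.
by rewrite rmorphXn/= !conjCK.
Qed.

Lemma inner_pencil l x : inner (pencil l x) x = (rnorm x ^+ 2)%:C%C +
  l * (rayleigh D (sqrtA0inv A x))%:C%C + l ^+ 2 * (rnorm (invsqrtA0 x) ^+ 2)%:C%C.
Proof.
rewrite /pencil !innerDl !innerZl invsqrtA0_sym !innerE !rnormE -!rmorphXn.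
congr (_ + _ * _ + _); rewrite /rayleigh -S_form RRe_real//.
by rewrite CrealE; apply/eqP; rewrite [RHS]innerC -S_sym.
Qed.

End HalfSpace.

(** * The spectrum and the numerical range *)

(** Through A_0^{1/2}, this is the joint numerical range of the self-adjoint
    operators [sandwich D] and A_0^{-1}. *)
Definition damping_range (R : realType) (H : hilbertType R)
    (A : positive_operator H) (D : {linear Hhalf A -> Hneg A}) : set (R * R) :=
  [set (rayleigh D z, rnorm (val z) ^+ 2) | z in [set z | rnorm z = 1]].

Lemma closure_ler (R : realType) (T : topologicalType) (f g : T -> R)
    (W : set T) : continuous f -> continuous g ->
  (forall p, W p -> f p <= g p) -> forall p, closure W p -> f p <= g p.
Proof.
move=> cf cg fg p Wp.
have cl : closed ((fun p => f p - g p) @^-1` [set x | x <= 0]).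
  by apply: preimage_closed (@closed_le _ 0) => q _; apply: cvgB; [exact: cf|exact: cg].
have := closureS _ Wp.
move=> /(_ ((fun p => f p - g p) @^-1` [set x | x <= 0])).
rewrite -(proj1 (closure_id _) cl)/= subr_le0; apply.
by move=> q Wq /=; rewrite subr_le0 fg.
Qed.

(** A bounded set of the plane has a compact closure, on which [F] attains its
    minimum. *)
Lemma closure_gt0_min (R : realType) (W : set (R * R)) (M N : R)
    (F : R * R -> R) : (forall p, W p -> 0 <= p.1 <= M /\ 0 <= p.2 <= N) ->
  continuous F -> (forall p, closure W p -> 0 < F p) ->
  exists2 c, 0 < c & forall p, W p -> c <= F p.
Proof.
move=> WMN cF F0; have [[p0 Wp0]|W0] := pselect (W !=set0); last first.
  by exists 1 => // p Wp; case: W0; exists p.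
have c1 : continuous (fst : R * R -> R) by move=> p; exact: cvg_fst.
have c2 : continuous (snd : R * R -> R) by move=> p; exact: cvg_snd.
have cst (a : R) : continuous (fun _ : R * R => a) by move=> p; exact: cvg_cst.
have cW : compact (closure W).
  apply: (@subclosed_compact _ _ (`[0, M] `*` `[0, N])).
  - exact: closed_closure.
  - by apply: compact_setX; exact: segment_compact.
  - move=> p Wp; split=> /=; rewrite in_itv/=; apply/andP; split.
    + by apply: (closure_ler (cst 0) c1) Wp => q /WMN[/andP[]].
    + by apply: (closure_ler c1 (cst M)) Wp => q /WMN[/andP[]].
    + by apply: (closure_ler (cst 0) c2) Wp => q /WMN[_ /andP[]].
    + by apply: (closure_ler c2 (cst N)) Wp => q /WMN[_ /andP[]].
have W0 : closure W !=set0 by exists p0; exact: subset_closure.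
have [p + Fp] := compact_EVT_min W0 cW (continuous_subspaceT cF).
rewrite inE => Wp; exists (F p); first exact: F0.
by move=> q Wq; apply: Fp; rewrite inE; exact: subset_closure.
Qed.

Lemma rnorm_complex_sqr (R : realType) (z : R[i]) :
  rnorm (z : R[i]^o) ^+ 2 = complex.Re z ^+ 2 + complex.Im z ^+ 2.
Proof. by apply: complexI; rewrite add_Re2_Im2 rmorphXn/= -rnormE. Qed.

Lemma continuous_affine_sqnorm (R : realType) (l1 l2 : R[i]) :
  continuous (fun p : R * R =>
    rnorm (1 + l1 * p.1%:C%C + l2 * p.2%:C%C : R[i]^o) ^+ 2).
Proof.
case: l1 l2 => [a b] [a' b'].
rewrite (_ : (fun p => _) = fun p : R * R =>
  (1 + a * p.1 + a' * p.2) ^+ 2 + (0 + b * p.1 + b' * p.2) ^+ 2); last first.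
  apply/funext => -[x y]; rewrite rnorm_complex_sqr/=.
  by congr (_ ^+ 2 + _ ^+ 2); ring.
have c1 : continuous (fst : R * R -> R) by move=> p; exact: cvg_fst.
have c2 : continuous (snd : R * R -> R) by move=> p; exact: cvg_snd.
have lin (c d e : R) : continuous (fun p : R * R => c + d * p.1 + e * p.2).
  move=> p; apply: cvgD; first (apply: cvgD; first exact: cvg_cst).
    by apply: cvgMr; exact: c1.
  by apply: cvgMr; exact: c2.
by move=> p; apply: cvgD; apply: cvgM; exact: lin.
Qed.

(** Otherwise [|1 + l s + l^2 k|] stays away from 0 on [damping_range D] by
    compactness; by homogeneity the pencil is then coercive, and [l] belongs to
    the resolvent set. *)
Lemma spectrum_root (R : realType) (H : hilbertType R)
    (A : positive_operator H) (D : {linear Hhalf A -> Hneg A})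
    (D_bounded : continuous D)
    (D_accretive : forall z : Hhalf A, 0 <= complex.Re (D z z))
    (D_H1 : forall z : Hhalf A, dom (A0 A) (val z) -> range (embed A) (D z))
    (D_selfadjoint : bounded_selfadjoint (sandwich D)) (l : R[i]) :
  spectrum (opA D) l -> exists2 p, closure (damping_range D) p &
    1 + l * p.1%:C%C + l ^+ 2 * p.2%:C%C = 0.
Proof.
move=> lspec; apply: contra_notP lspec => noroot.
have [[[_ Sl] _ Ssa] Sc] := D_selfadjoint.
have Slin : linear (sandwich D) by move=> a x y; have [] := Sl a x y I I.
pose S : {linear H -> H} :=
  HB.pack (sandwich D) (GRing.isLinear.Build _ _ _ _ _ Slin).
have form h k : inner (S h) k = D (sqrtA0inv A h) (sqrtA0inv A k).
  exact: sandwich_form.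
have Ssym x y : inner (S x) y = inner x (S y).
  by have [_ h] := Ssa y (S y); exact: (h (conj I erefl)).
have Sbnd : bounded_map S by apply/bounded_mapP.
have [N N0 vN] := bounded_val A.
have [M M0 SM] := Sbnd.
pose q (p : R * R) : R[i] := 1 + l * p.1%:C%C + l ^+ 2 * p.2%:C%C.
pose F (p : R * R) : R := rnorm (q p : R[i]^o) ^+ 2.
have [||p Wp|c c0 cF] := @closure_gt0_min R (damping_range D) M (N ^+ 2) F.
- move=> _ [z /= z1 <-] /=; split; apply/andP; split=> //.
  + by rewrite /rayleigh D_accretive.
  + rewrite /rayleigh -(sqrtA0half_inv z) -form.
    apply: (le_trans (ler_norm _)); rewrite -lecR.
    apply: (le_trans (normc_ge_Re _)); rewrite (rnormE (_ : R[i]^o)) lecR.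
    apply: (le_trans (rnorm_inner_le _ _)).
    rewrite rnorm_sqrtA0half z1 mulr1 (le_trans (SM _))//.
    by rewrite rnorm_sqrtA0half z1 mulr1.
  + by rewrite exprn_ge0 ?rnorm_ge0.
  + by rewrite lerXn2r ?nnegrE ?rnorm_ge0// (le_trans (vN _))// z1 mulr1.
- exact: continuous_affine_sqnorm.
- rewrite /F exprn_even_gt0//=; apply/eqP => /rnorm0_eq0 qp0.
  by apply: noroot; exists p.
have coer (x : H) : Num.sqrt c * rnorm x ^+ 2 <=
    rnorm (inner (pencil A S l x) x : R[i]^o).
  have [->|x0] := eqVneq x 0.
    by rewrite {1}/rnorm normr0 expr0n mulr0 rnorm_ge0.
  have xp := rnorm_gt0 x0; set t := rnorm x in xp *.
  pose z := t^-1%:C%C *: sqrtA0inv A x.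
  have z1 : rnorm z = 1.
    rewrite rnormZ rnorm_real gtr0_norm ?invr_gt0// -rnorm_sqrtA0half.
    by rewrite sqrtA0inv_half mulVf// gt_eqF.
  have := cF _ (ex_intro2 _ _ z z1 erefl).
  have -> : inner (pencil A S l x) x =
      (t ^+ 2)%:C%C * q (rayleigh D z, rnorm (val z) ^+ 2).
    have t0 : t != 0 by rewrite gt_eqF.
    have -> : rayleigh D z = rayleigh D (sqrtA0inv A x) / t ^+ 2.
      rewrite /rayleigh /z linearZ.
      have -> (y : Hneg A) v : (t^-1%:C%C *: y) v = t^-1%:C%C * y v by [].
      rewrite Hneg_scale conj_Creal; last by apply/complex_realP; exists t^-1.
      case: (D _ _) => a b /=; field; exact: t0.
    have -> : rnorm (val z) ^+ 2 = rnorm (invsqrtA0 A x) ^+ 2 / t ^+ 2.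
      rewrite /z linearZ rnormZ rnorm_real gtr0_norm ?invr_gt0//.
      by rewrite exprMn exprVn mulrC.
    rewrite (inner_pencil form Ssym) /q -/t /= !rmorphM/= !fmorphV/=.
    field; rewrite -[0]/(0%:C%C) (inj_eq (@complexI R)) ?expf_neq0//.
  rewrite /F => cq; rewrite -[_ * q _]/(_ *: (q _ : R[i]^o)) rnormZ rnorm_real.
  rewrite ger0_norm ?exprn_ge0 ?(ltW xp)// mulrC ler_wpM2l ?exprn_ge0 ?(ltW xp)//.
  by rewrite -[leRHS]ger0_norm ?rnorm_ge0// -sqrtr_sqr ler_wsqrtr.
have [||x y|||G [bG GK KG]] :=
  @coercive_inverse R H (pencil A S l) (pencil A S (Num.conj l)) (Num.sqrt c).
- exact: bounded_pencil.
- exact: bounded_pencil.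
- exact: pencil_adjoint.
- by rewrite sqrtr_gt0.
- exact: coer.
exact: (resolvent_opA form Sbnd bG GK KG).
Qed.

(** * The constants of the damping *)

Section DampingConstants.
Context (R : realType) (H : hilbertType R) (A : positive_operator H).
Context (D : {linear Hhalf A -> Hneg A}).
Hypothesis D_accretive : forall z : Hhalf A, 0 <= complex.Re (D z z).
Implicit Type z : Hhalf A.

Lemma rnorm_val_gt0 z : z != 0 -> 0 < rnorm (val z).
Proof. by move=> z0; rewrite rnorm_gt0// -(raddf0 val) (inj_eq val_inj). Qed.

Lemma rayleigh_ge0 z : 0 <= rayleigh D z.
Proof. exact: D_accretive. Qed.

Lemma inf_ratio_le (E : set (Hhalf A)) (q : Hhalf A -> R) z :
  (forall w, E w -> 0 < q w) -> E z ->
  inf [set rayleigh D w / q w | w in E] * q z <= rayleigh D z.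
Proof.
move=> q0 Ez; rewrite -ler_pdivlMr ?q0//; apply: ge_inf; last by exists z.
by exists 0 => _ [w Ew <-]; rewrite divr_ge0 ?rayleigh_ge0// ltW// q0.
Qed.

Lemma Dbeta_le z : z != 0 -> Dbeta D * rnorm (val z) ^+ 2 <= rayleigh D z.
Proof.
by apply: inf_ratio_le => w w0; rewrite exprn_gt0 ?rnorm_val_gt0.
Qed.

Lemma Ddelta_le z : z != 0 -> Ddelta D * rnorm z ^+ 2 <= rayleigh D z.
Proof. by apply: inf_ratio_le => w w0; rewrite exprn_gt0 ?rnorm_gt0. Qed.

Lemma Dmu_le z : z != 0 -> Dmu D * (rnorm (val z) * rnorm z) <= rayleigh D z.
Proof.
by apply: inf_ratio_le => w w0; rewrite mulr_gt0 ?rnorm_gt0 ?rnorm_val_gt0.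
Qed.

Lemma Dgamma_ge z : (Dgamma D < +oo)%E -> z != 0 ->
  rayleigh D z <= fine (Dgamma D) * rnorm (val z) ^+ 2.
Proof.
move=> Doo z0; have k0 : 0 < rnorm (val z) ^+ 2 by rewrite exprn_gt0 ?rnorm_val_gt0.
rewrite -ler_pdivrMr//.
have : ((rayleigh D z / rnorm (val z) ^+ 2)%:E <= Dgamma D)%E.
  by apply: ereal_sup_ubound; exists z.
by move: Doo; case: (Dgamma D).
Qed.

(** The norm of H_{1/2} dominates a multiple of that of H, hence the quotient
    defining beta dominates a multiple of the one defining mu. *)
Lemma Dbeta_gt0 : 0 < Dmu D -> 0 < Dbeta D.
Proof.
move=> mu0; have [N N0 vN] := bounded_val A.
have N1 : 0 < N + 1 by rewrite ltr_wpDl.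
apply: (@lt_le_trans _ _ (Dmu D / (N + 1))); first exact: divr_gt0.
apply: lb_le_inf.
  apply: contrapT => Z0; move: mu0; rewrite /Dmu.
  suff -> : [set z : Hhalf A | z != 0] = set0 by rewrite image_set0 inf0 ltxx.
  rewrite -subset0 => z z0; apply: Z0.
  by exists (rayleigh D z / rnorm (val z) ^+ 2); exists z.
move=> _ [z z0 <-]; have v0 := rnorm_val_gt0 z0.
rewrite ler_pdivlMr ?exprn_gt0// (le_trans _ (Dmu_le z0))//.
rewrite -mulrA ler_wpM2l ?(ltW mu0)// ler_pdivrMl// expr2 mulrCA.
by rewrite ler_wpM2l ?(ltW v0)// (le_trans (vN z))// ler_wpM2r ?rnorm_ge0// lerDl.
Qed.

(** The constraints are multiplied out, since [p.2] may vanish in the limit. *)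
Lemma damping_range_closure p : 0 < Dmu D -> closure (damping_range D) p ->
  [/\ 0 <= p.2, Dbeta D * p.2 <= p.1, Ddelta D <= p.1,
      Dmu D ^+ 2 * p.2 <= p.1 ^+ 2 &
      (Dgamma D < +oo)%E -> p.1 <= fine (Dgamma D) * p.2].
Proof.
move=> mu0 Wp.
have c1 : continuous (fst : R * R -> R) by move=> q; exact: cvg_fst.
have c2 : continuous (snd : R * R -> R) by move=> q; exact: cvg_snd.
have cst (a : R) : continuous (fun _ : R * R => a) by move=> q; exact: cvg_cst.
have scale a : continuous (fun q : R * R => a * q.2).
  by move=> q; apply: cvgMr; exact: c2.
have sq1 : continuous (fun q : R * R => q.1 ^+ 2).
  by move=> q; apply: cvgM; exact: c1.
have unit z : rnorm z = 1 -> z != 0.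
  by move=> z1; apply: contra_eqN z1 => /eqP->; rewrite /rnorm normr0 eq_sym oner_eq0.
split=> [|||| Doo].
- by apply: (closure_ler (cst 0) c2) Wp => _ [z /= z1 <-]; rewrite exprn_ge0 ?rnorm_ge0.
- by apply: (closure_ler (scale _) c1) Wp => _ [z /= z1 <-]; exact/Dbeta_le/unit.
- apply: (closure_ler (cst _) c1) Wp => _ [z /= z1 <-].
  by have := Ddelta_le (unit z z1); rewrite z1 expr1n mulr1.
- apply: (closure_ler (scale _) sq1) Wp => _ [z /= z1 <-].
  have := Dmu_le (unit z z1); rewrite z1 mulr1 => h.
  by rewrite -exprMn lerXn2r ?nnegrE ?rayleigh_ge0// mulr_ge0 ?rnorm_ge0 ?(ltW mu0).
- apply: (closure_ler c1 (scale _)) Wp => _ [z /= z1 <-].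
  exact/Dgamma_ge/unit.
Qed.

End DampingConstants.

(** * Enclosures of the spectrum *)

Section RegionMembership.
Context (R : realType).
Implicit Types (l : R[i]) (I : interval R).

Lemma real_pointsP I l : complex.Im l = 0 -> complex.Re l \in I ->
  real_points I l.
Proof. by case: l => x y /= -> xI; exists x. Qed.

Lemma sectorP (m : R) l : 0 < m < 2 ->
  m ^+ 2 * complex.Im l ^+ 2 <= (4 - m ^+ 2) * complex.Re l ^+ 2 -> sector m l.
Proof.
move=> /andP[m0 m2] h; rewrite /sector/= mulrAC ler_pdivlMr//.
have m4 : 0 <= 4 - m ^+ 2 by nra.
rewrite -[leLHS]ger0_norm ?mulr_ge0 ?(ltW m0)// -sqrtr_sqr.
rewrite -[`|complex.Re l|]sqrtr_sqr -sqrtrM// ler_wsqrtr//.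
by rewrite exprMn real_normK ?num_real// mulrC.
Qed.

Lemma discP (d : R) l : 0 < d ->
  d * (complex.Re l ^+ 2 + complex.Im l ^+ 2) + 2 * complex.Re l <= 0 ->
  disc d l.
Proof.
case: l => x y /= d0 h; rewrite /disc/= normc_def lecR/= addr0.
have di : 0 < d^-1 by rewrite invr_gt0.
rewrite -[leRHS]ger0_norm ?(ltW di)// -sqrtr_sqr ler_wsqrtr//.
have := ler_wpM2l (ltW di) h.
rewrite mulr0 mulrDr mulrA mulVf ?gt_eqF// mul1r; nra.
Qed.

End RegionMembership.

Theorem proposition7p4 (R : realType) (H : hilbertType R)
    (A : positive_operator H) (D : {linear Hhalf A -> Hneg A})
    (D_bounded : continuous D)
    (D_accretive : forall z : Hhalf A, 0 <= complex.Re (D z z))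
    (D_H1 : forall z : Hhalf A, dom (A0 A) (val z) -> range (embed A) (D z))
    (D_selfadjoint : bounded_selfadjoint (sandwich D)) :
  let sigma := spectrum (opA D) in
  let b := Dbeta D in
  let d := Ddelta D in
  let m := Dmu D in
  let g := fine (Dgamma D) in
  let r := Num.sqrt (1 - 4 / (b * d)) in
  (* (a) *)
  (2 <= m ->
    [/\ Dgamma D = +oo%E -> sigma `<=` real_points `]-oo, 0[,
        (Dgamma D < +oo)%E -> sigma `<=` real_points `[- g, 0[
      & 0 < d -> 0 < b /\ (4 < b * d ->
        (Dgamma D = +oo%E ->
          sigma `<=` real_points `]-oo, (- (b / 2 * (1 + r)))]
                 `|` real_points `[(- (b / 2 * (1 - r))), 0[) /\
        ((Dgamma D < +oo)%E ->
          sigma `<=` real_points `[- g, (- (b / 2 * (1 + r)))]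
                 `|` real_points `[(- (b / 2 * (1 - r))), 0[))]) /\
  (* (b) *)
  (0 < m < 2 ->
    [/\ 0 < b,
        Dgamma D = +oo%E ->
          sigma `<=` (strip `]-oo, (- (b / 2))] `&` sector m)
                 `|` real_points `[(- (b / 2)), 0[,
        (Dgamma D < +oo)%E ->
          sigma `<=` real_points `[(- g), (- (g / 2))]
                 `|` (strip `[(- (g / 2)), (- (b / 2))] `&` sector m)
                 `|` real_points `[(- (b / 2)), 0[
      & 0 < d ->
        [/\ Dgamma D = +oo%E ->
              sigma `<=` real_points `]-oo, (- (2 / d))[
                `|` (strip `[(- (2 / d)), (- (m ^+ 2 / (2 * d)))] `&` disc d)
                `|` (strip `[(- (m ^+ 2 / (2 * d))), (- (b / 2))] `&` sector m)
                `|` real_points `[(- (b / 2)), 0[,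
            (Dgamma D < +oo)%E -> m ^+ 2 < g * d ->
              sigma `<=` real_points `[(- g), (- Num.min (2 / d) (g / 2))[
                `|` (strip `[(- Num.min (2 / d) (g / 2)),
                             (- (m ^+ 2 / (2 * d)))] `&` disc d)
                `|` (strip `[(- (m ^+ 2 / (2 * d))), (- (b / 2))] `&` sector m)
                `|` real_points `[(- (b / 2)), 0[
          & (Dgamma D < +oo)%E -> g * d <= m ^+ 2 ->
              sigma `<=` real_points `[(- g), (- (g / 2))[
                `|` (strip `[(- (g / 2)), (- (b / 2))] `&` sector m)
                `|` real_points `[(- (b / 2)), 0[] ]).
Proof.
move=> sigma b d m g r.
have root (l : R[i]) : 0 < m -> sigma l -> exists s k : R,
    [/\ [/\ 0 <= s, 0 <= k, b * k <= s, d <= s & m ^+ 2 * k <= s ^+ 2],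
        (Dgamma D < +oo)%E -> s <= g * k,
        1 + s * complex.Re l + k * (complex.Re l ^+ 2 - complex.Im l ^+ 2) = 0,
        complex.Im l * (s + 2 * k * complex.Re l) = 0 & complex.Re l < 0].
  move=> m0 /(spectrum_root D_bounded D_accretive D_H1 D_selfadjoint)[p Wp].
  move=> /pencil_root_ReIm[re0 im0].
  have [k0 bk dk mk gk] := damping_range_closure D_accretive m0 Wp.
  have s0 : 0 <= p.1.
    by rewrite (le_trans _ bk)// mulr_ge0// ltW//; exact: Dbeta_gt0.
  exists p.1, p.2; split=> //.
  exact: (root_Re_lt0 s0 k0 re0 im0 m0 mk).
split=> [m2|m02].
- have m0 : 0 < m by rewrite (lt_le_trans _ m2).
  have b0 : 0 < b by exact: Dbeta_gt0.
  have real l : sigma l -> [/\ complex.Im l = 0, complex.Re l < 0 &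
      (Dgamma D < +oo)%E -> - g <= complex.Re l].
    move=> /(root l m0)[s [k [[s0 k0 bk dk mk] gk re0 im0 x0]]].
    have y0 := root_real k0 re0 im0 m2 mk.
    by split=> // /gk gk'; exact: (root_ge s0 k0 re0 gk' x0 y0).
  split=> [_|Doo|d0].
  + by move=> l /real[y0 x0 _]; apply: real_pointsP; rewrite ?in_itv.
  + by move=> l /real[y0 x0 /(_ Doo) xg]; apply: real_pointsP; rewrite ?in_itv/= ?xg.
  split=> // bd.
  have gap l : sigma l -> complex.Re l <= - (b / 2 * (1 + r)) \/
      - (b / 2 * (1 - r)) <= complex.Re l.
    move=> /(root l m0)[s [k [[s0 k0 bk dk mk] gk re0 im0 x0]]].
    have y0 := root_real k0 re0 im0 m2 mk.
    have := root_gap re0 b0 d0 bk dk x0 y0.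
    have r2 : r ^+ 2 = 1 - 4 / (b * d).
      rewrite sqr_sqrtr// subr_ge0 ler_pdivrMr ?mul1r ?(ltW bd)//.
      exact: mulr_gt0.
    (* With this value of b / d, the polynomial of root_gap splits over R. *)
    have -> : b / d = b ^+ 2 / 4 * (1 - r ^+ 2).
      by rewrite r2; field; rewrite !gt_eqF.
    move: (complex.Re l) x0 => x x0 h.
    have r0 : 0 <= r by exact: sqrtr_ge0.
    have br : 0 <= b * r by rewrite mulr_ge0// ltW.
    have [?|xr] := lerP x (- (b / 2 * (1 + r))); first by left.
    right; rewrite leNgt; apply/negP => xl.
    have : 0 < (x + b / 2 * (1 + r)) * (b / 2 * (- 1 + r) - x).
      by rewrite mulr_gt0//; lra.
    by nra.
  split=> [_|Doo] l sl; have [y0 x0 xg] := real l sl;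
    case: (gap l sl) => x_r; [left|right|left|right];
    by apply: real_pointsP; rewrite ?in_itv/= ?x_r ?x0 ?xg.
have [m0 m2] := andP m02.
have b0 : 0 < b by exact: Dbeta_gt0.
have sect l : sigma l -> sector m l.
  move=> /(root l m0)[s [k [[s0 k0 bk dk mk] gk re0 im0 x0]]].
  apply: sectorP => //; have [->|y0] := eqVneq (complex.Im l) 0.
    by rewrite expr0n mulr0 mulr_ge0 ?sqr_ge0//; nra.
  exact: (nonreal_root_sector k0 re0 im0 mk y0).
(* A real point only needs the bound by g, since the sector contains the real
   axis and the disc contains the interval from - 2 / d to 0. *)
have enclosure l : sigma l -> complex.Re l < 0 /\
    ((complex.Im l = 0 /\ ((Dgamma D < +oo)%E -> - g <= complex.Re l)) \/
     [/\ complex.Re l <= - (b / 2),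
         (Dgamma D < +oo)%E -> - (g / 2) <= complex.Re l &
         0 < d -> d * (complex.Re l ^+ 2 + complex.Im l ^+ 2) + 2 * complex.Re l <= 0]).
  move=> /(root l m0)[s [k [[s0 k0 bk dk mk] gk re0 im0 x0]]]; split=> //.
  have [y0|y0] := eqVneq (complex.Im l) 0; [left|right]; split=> //.
  - by move=> /gk gk'; exact: (root_ge s0 k0 re0 gk' x0 y0).
  - exact: (nonreal_root_le k0 re0 im0 bk y0).
  - by move=> /gk gk'; exact: (nonreal_root_ge k0 re0 im0 gk' y0).
  - by move=> _; exact: (nonreal_root_disc k0 re0 im0 dk y0).
split=> // [_ l sl|Doo l sl|d0].
- have [x0 [[y0 _]|[xb _ _]]] := enclosure l sl; last first.
    by left; split; [rewrite /strip/= in_itv|exact: sect].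
  have [xb|xb] := lerP (complex.Re l) (- (b / 2)).
    by left; split; [rewrite /strip/= in_itv|exact: sect].
  by right; apply: real_pointsP; rewrite ?in_itv/= ?(ltW xb).
- have [x0 [[y0 /(_ Doo) xg]|[xb /(_ Doo) xg _]]] := enclosure l sl; last first.
    by left; right; split; [rewrite /strip/= in_itv/= xg|exact: sect].
  have [xg2|xg2] := lerP (complex.Re l) (- (g / 2)).
    by left; left; apply: real_pointsP; rewrite ?in_itv/= ?xg.
  have [xb|xb] := lerP (complex.Re l) (- (b / 2)).
    by left; right; split; [rewrite /strip/= in_itv/= (ltW xg2)|exact: sect].
  by right; apply: real_pointsP; rewrite ?in_itv/= ?(ltW xb).
have real_disc l : complex.Im l = 0 -> - (2 / d) <= complex.Re l ->
    complex.Re l < 0 -> disc d l.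
  move=> y0 xd x0; apply: discP => //; rewrite y0.
  by move: xd; rewrite -mulNr ler_pdivrMr// => xd; nra.
have disc_ge l : d * (complex.Re l ^+ 2 + complex.Im l ^+ 2) + 2 * complex.Re l <= 0 ->
    complex.Re l < 0 -> - (2 / d) <= complex.Re l.
  move=> h x0; rewrite -mulNr ler_pdivrMr//.
  by have := sqr_ge0 (complex.Im l); nra.
split=> [_ l sl|Doo _ l sl|Doo _ l sl].
- have [x0 [[y0 _]|[xb _ /(_ d0) dl]]] := enclosure l sl; last first.
    have xd := disc_ge l dl x0.
    have [xm|xm] := lerP (complex.Re l) (- (m ^+ 2 / (2 * d))).
      by left; left; right; split; [rewrite /strip/= in_itv/= xd|exact: discP].
    by left; right; split; [rewrite /strip/= in_itv/= (ltW xm)|exact: sect].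
  have [xd|xd] := ltrP (complex.Re l) (- (2 / d)).
    by left; left; left; apply: real_pointsP; rewrite ?in_itv.
  have [xm|xm] := lerP (complex.Re l) (- (m ^+ 2 / (2 * d))).
    by left; left; right; split; [rewrite /strip/= in_itv/= xd|exact: real_disc].
  have [xb|xb] := lerP (complex.Re l) (- (b / 2)).
    by left; right; split; [rewrite /strip/= in_itv/= (ltW xm)|exact: sect].
  by right; apply: real_pointsP; rewrite ?in_itv/= ?(ltW xb).
- have [x0 [[y0 /(_ Doo) xg]|[xb /(_ Doo) xg /(_ d0) dl]]] := enclosure l sl; last first.
    have xd : - Num.min (2 / d) (g / 2) <= complex.Re l.
      by rewrite lerNl le_min; apply/andP; split; rewrite lerNl//; exact: disc_ge.
    have [xm|xm] := lerP (complex.Re l) (- (m ^+ 2 / (2 * d))).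
      by left; left; right; split; [rewrite /strip/= in_itv/= xd|exact: discP].
    by left; right; split; [rewrite /strip/= in_itv/= (ltW xm)|exact: sect].
  have [xd|xd] := ltrP (complex.Re l) (- Num.min (2 / d) (g / 2)).
    by left; left; left; apply: real_pointsP; rewrite ?in_itv/= ?xg.
  have [xm|xm] := lerP (complex.Re l) (- (m ^+ 2 / (2 * d))).
    left; left; right; split; first by rewrite /strip/= in_itv/= xd.
    apply: real_disc => //; apply: le_trans xd.
    by rewrite lerN2 ge_min lexx.
  have [xb|xb] := lerP (complex.Re l) (- (b / 2)).
    by left; right; split; [rewrite /strip/= in_itv/= (ltW xm)|exact: sect].
  by right; apply: real_pointsP; rewrite ?in_itv/= ?(ltW xb).
- have [x0 [[y0 /(_ Doo) xg]|[xb /(_ Doo) xg _]]] := enclosure l sl; last first.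
    by left; right; split; [rewrite /strip/= in_itv/= xg|exact: sect].
  have [xg2|xg2] := ltrP (complex.Re l) (- (g / 2)).
    by left; left; apply: real_pointsP; rewrite ?in_itv/= ?xg.
  have [xb|xb] := lerP (complex.Re l) (- (b / 2)).
    by left; right; split; [rewrite /strip/= in_itv/= xg2|exact: sect].
  by right; apply: real_pointsP; rewrite ?in_itv/= ?(ltW xb).
Qed.
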